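(* Let $A\in\mathbb{R}^{m\times n}$, let $\mathcal{P}\subseteq\mathbb{R}^\ell$ be a (nonempty) polyhedron, $M\in\mathbb{R}^{\ell\times n}$, and $r=\sigma_{\mathcal{P}}\circ M$. Let $S:\mathbb{R}^m\times\mathbb{R}_{++}\rightrightarrows\mathbb{R}^n$ be given by $$S(b,\lambda)=\operatorname*{argmin}_{x\in\mathbb{R}^n}\Bigl\{\tfrac12\|Ax-b\|^2+\lambda r(x)\Bigr\}.$$ Let $(\bar b,\bar\lambda)\in\mathbb{R}^m\times\mathbb{R}_{++}$, $\bar x\in S(\bar b,\bar\lambda)$, $\bar v:=-\frac1{\bar\lambda}A^T(A\bar x-\bar b)$, and $$\Lambda(\bar x,\bar v):=\{y\in\mathbb{R}^\ell\mid M^Ty=\bar v,\ y\in N_{\mathcal{P}}^{-1}(M\bar x)\}.$$ If for any $\bar y\in\Lambda(\bar x,\bar v)$ we have $$\ker A\cap\operatorname{span}M^{-1}(N_{\mathcal{P}}(\bar y))=\{0\},$$ then the following hold: (a) $S$ is semismooth (in particular, single-valued, locally Lipschitz, and directionally differentiable) at $(\bar b,\bar\lambda)$, and for each direction $(q,\alpha)\in\mathbb{R}^m\times\mathbb{R}$ there exists a matrix $Q$ with orthonormal columns such that the directional derivative in direction $(q,\alpha)$ is given by $$S'(\bar b,\bar\lambda;q,\alpha)=Q[(AQ)^T(AQ)]^{-1}(AQ)^T\Bigl(q+\frac{\alpha}{\bar\lambda}(A\bar x-\bar b)\Bigr).$$ (b) For any $\bar y\in\Lambda(\bar x,\bar v)$,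 the modulus $L$ of Lipschitz continuity of $S$ at $(\bar b,\bar\lambda)$ can be bounded by $$L\le\frac1{\sigma_{\min}(A\overline Q)^2}\Bigl(\sigma_{\max}(A\overline Q)+\frac1{\bar\lambda}\bigl\|(A\overline Q)^T(A\bar x-\bar b)\bigr\|\Bigr),$$ where $\overline Q$ is a matrix whose columns form an orthonormal basis of $\operatorname{span}M^{-1}(N_{\mathcal{P}}(\bar y))$.
   Context: $\sigma_{\mathcal{P}}(u)=\sup_{z\in\mathcal{P}}\langle u,z\rangle$ is the support function. $N_{\mathcal{P}}(y)$ is the normal cone of convex analysis to $\mathcal{P}$ at $y$ (empty if $y\notin\mathcal{P}$), and $N_{\mathcal{P}}^{-1}(u)=\{y\mid u\in N_{\mathcal{P}}(y)\}$. For a set $D$, $M^{-1}(D)=\{x\mid Mx\in D\}$. $\sigma_{\min},\sigma_{\max}$ denote smallest and largest singular values ($\sigma_{\min}(A\overline Q)^2=\lambda_{\min}((A\overline Q)^T(A\overline Q))$). All norms are Euclidean. Local Lipschitz continuity at a point means single-valuedness and Lipschitz continuity on a neighborhood; the modulus is $L=\limsup_{p,p'\to\bar p,\,p\neq p'}\|S(p)-S(p')\|/\|p-p'\|$ with $\bar p=(\bar b,\bar\lambda)$. The directional derivative is $S'(\bar p;d)=\lim_{t\downarrow0}(S(\bar p+td)-S(\bar p))/t$. $S$ is semismooth at $\bar p$ if it is locally Lipschitz at $\bar p$ and for every $h$ the limit of $Vh'$ over $V\in\partial_CS(\bar p+th')$, $h'\to h$, $t\downarrow0$, exists, where $\partial_C$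 is Clarke's generalized Jacobian (convex hull of limits of Jacobians at nearby differentiability points). Convention for the degenerate case: a matrix with orthonormal columns (basis of the zero subspace) may have no columns, in which case the expression in (a) is $0$ and the bound in (b) is read as $0$. *)

(* Defs.v *)
From HB Require Import structures.
From mathcomp Require Import all_boot all_order all_algebra.
From mathcomp Require Import all_classical all_reals all_analysis.

Set Implicit Arguments.
Unset Strict Implicit.
Unset Printing Implicit Defensive.
Import Order.TTheory GRing.Theory Num.Theory.
Import numFieldNormedType.Exports.

Local Open Scope classical_set_scope.
Local Open Scope ring_scope.

(* MathComp-Analysis, vectors of R^n being columns 'cV[R]_n. *)

Section Euclidean.
Context {R : realType}.

Definition dotv n (u v : 'cV[R]_n) : R := (u^T *m v) 0 0.

(* The norm `|x| that MathComp-Analysis puts on matrices is the max norm. It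
   gives the same topology, but not the same Lipschitz moduli. *)
Definition enorm n (x : 'cV[R]_n) : R := Num.sqrt (dotv x x).

Definition lin_span n (D : set 'cV[R]_n) : set 'cV[R]_n :=
  [set x | exists k (c : 'I_k -> R) (d : 'I_k -> 'cV[R]_n),
     (forall i, D (d i)) /\ x = \sum_(i < k) c i *: d i].

Definition conv_hull m n (D : set 'M[R]_(m, n)) : set 'M[R]_(m, n) :=
  [set V | exists k (w : 'I_k -> R) (d : 'I_k -> 'M[R]_(m, n)),
     [/\ forall i, 0 <= w i, \sum_(i < k) w i = 1, forall i, D (d i)
       & V = \sum_(i < k) w i *: d i]].

Definition orthonormal_cols n k (Q : 'M[R]_(n, k)) : Prop :=
  Q^T *m Q = 1%:M.

Definition orthonormal_basis n k (Q : 'M[R]_(n, k)) (W : set 'cV[R]_n) : Prop :=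
  orthonormal_cols Q /\ W = [set x | exists c : 'cV[R]_k, x = Q *m c].

(* One singular value per column, counted through the eigenvalues of B^T B. *)
Definition singular_value m k (B : 'M[R]_(m, k)) : set R :=
  [set s | 0 <= s /\ eigenvalue (B^T *m B) (s ^+ 2)].

(* The set of singular values is finite, and nonempty if k > 0, so these are a
   minimum and a maximum. Both are 0 if k = 0, because inf set0 = sup set0 = 0. *)
Definition sigma_min m k (B : 'M[R]_(m, k)) : R := inf (singular_value B).
Definition sigma_max m k (B : 'M[R]_(m, k)) : R := sup (singular_value B).

End Euclidean.

Section Convex.
Context {R : realType}.

Definition polyhedron l (P : set 'cV[R]_l) : Prop :=
  exists k (G : 'M[R]_(k, l)) (g : 'cV[R]_k),
    P = [set z | forall i, (G *m z) i 0 <= g i 0].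

Definition support_fun l (P : set 'cV[R]_l) (u : 'cV[R]_l) : \bar R :=
  ereal_sup [set (dotv u z)%:E | z in P].

Definition normal_cone l (P : set 'cV[R]_l) (y : 'cV[R]_l) : set 'cV[R]_l :=
  [set u | P y /\ forall z, P z -> dotv u (z - y) <= 0].

Definition normal_cone_inv l (P : set 'cV[R]_l) (u : 'cV[R]_l) : set 'cV[R]_l :=
  [set y | normal_cone P y u].

Definition argmin T (f : T -> \bar R) : set T :=
  [set x | forall x', (f x <= f x')%E].

End Convex.

Section VariationalAnalysis.
Context {R : realType}.
Variables (N n : nat).
Implicit Types (f : 'cV[R]_N -> 'cV[R]_n) (p d h : 'cV[R]_N).

Definition locally_lipschitz_at f p : Prop :=
  exists K : R, \forall x \near p & y \near p,
    enorm (f x - f y) <= K * enorm (x - y).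

Definition lip_modulus f p : \bar R :=
  limf_esup
    (fun xy : 'cV[R]_N * 'cV[R]_N =>
       (enorm (f xy.1 - f xy.2) / enorm (xy.1 - xy.2))%:E)
    (within [set xy : 'cV[R]_N * 'cV[R]_N | xy.1 <> xy.2] (nbhs (p, p))).

Definition is_dir_derivative f p d (v : 'cV[R]_n) : Prop :=
  (fun t : R => t^-1 *: (f (p + t *: d) - f p)) @ 0^'+ --> v.

(* The library's [jacobian] is for row vectors and acts on the right. *)
Definition jac f p : 'M[R]_(n, N) :=
  \matrix_(i, j) ('d f p (delta_mx j 0 : 'cV[R]_N)) i 0.

Definition clarke_jacobian f p : set 'M[R]_(n, N) :=
  conv_hull [set V | exists u : nat -> 'cV[R]_N,
    [/\ u @ \oo --> p, forall k, differentiable f (u k)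
      & (fun k => jac f (u k)) @ \oo --> V]].

Definition semismooth_at f p : Prop :=
  locally_lipschitz_at f p /\
  forall h, exists v : 'cV[R]_n, forall e : R, 0 < e ->
    \forall h' \near h & t \near 0^'+,
      forall V, clarke_jacobian f (p + t *: h') V -> enorm (V *m h' - v) < e.

End VariationalAnalysis.

Section Problem.
Context {R : realType}.
Variables (m n l : nat).

(* R^m x R is identified with R^(m+1), whose Euclidean norm is that of the
   product. *)
Definition pair_pt (b : 'cV[R]_m) (lam : R) : 'cV[R]_(m + 1) :=
  col_mx b (const_mx lam).
Definition pt_b (p : 'cV[R]_(m + 1)) : 'cV[R]_m := usubmx p.
Definition pt_lam (p : 'cV[R]_(m + 1)) : R := dsubmx p 0 0.

Definition objective (A : 'M[R]_(m, n)) (P : set 'cV[R]_l) (M : 'M[R]_(l, n))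
    (b : 'cV[R]_m) (lam : R) (x : 'cV[R]_n) : \bar R :=
  ((2^-1 * enorm (A *m x - b) ^+ 2)%:E + lam%:E * support_fun P (M *m x))%E.

(* The domain is R^m x R_{++}: no solution is returned for lam <= 0. *)
Definition sol_map (A : 'M[R]_(m, n)) (P : set 'cV[R]_l) (M : 'M[R]_(l, n))
    (p : 'cV[R]_(m + 1)) : set 'cV[R]_n :=
  [set x | 0 < pt_lam p /\ argmin (objective A P M (pt_b p) (pt_lam p)) x].

Definition multipliers (P : set 'cV[R]_l) (M : 'M[R]_(l, n))
    (x v : 'cV[R]_n) : set 'cV[R]_l :=
  [set y | M^T *m y = v /\ normal_cone_inv P (M *m x) y].

Definition cone_span (P : set 'cV[R]_l) (M : 'M[R]_(l, n)) (y : 'cV[R]_l) :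
    set 'cV[R]_n :=
  lin_span [set x | normal_cone P y (M *m x)].

End Problem.

(* Main.v *)
Require Import Defs.
From HB Require Import structures.
From mathcomp Require Import all_boot all_order all_algebra.
From mathcomp Require Import all_classical all_reals all_analysis.
From mathcomp Require Import ring lra.
Import Order.TTheory GRing.Theory Num.Theory.
Import numFieldNormedType.Exports.
Local Open Scope classical_set_scope.
Local Open Scope ring_scope.
Set Implicit Arguments.
Unset Strict Implicit.
Unset Printing Implicit Defensive.

(** Put [C = M^T P]. It is again a polyhedron (Fourier-Motzkin elimination,
    [polyhedron_image]), the regularizer is its support function, and the set of
    [x] with [M x] normal to [P] at [y] is the normal cone of [C] at [M^T y]
    ([normal_cone_image]). So [M] and the multipliers disappear: [x] solves the
    problem for [(b, lam)] if and only if its dual point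
    [w = lam^-1 A^T (b - A x)] lies in [C] and [x] is normal to [C] at [w]
    ([minimizerP]), and the hypothesis says that [A] is injective on the span of
    the normal cone [N(v)] of [C] at the reference dual point [v].

    Polyhedrality enters through [normal_cone_near]: a solution [x] near the
    reference solution [xb], with dual point [w] near [v], satisfies
    [N(w) <= N(v)] and also [xb \in N(w)]. Three facts follow.

    - Differences of nearby solutions lie in the span of [N(v)]. Subtracting two
      optimality conditions and using that the normal cone is monotone gives
      uniqueness and the Lipschitz estimate of (b) ([regular_gap]). The singular
      values enter as extreme Rayleigh quotients. That solutions exist and stay
      near [xb] is a compactness argument ([minimizer_stable]).

    - Both [xb] and [x] belong to [N(w)] and to [N(v)], hence to the normal cone at
      every point between [v] and [w]. The optimality conditions, once multiplied
      by [lam], are linear in parameter, solution and scaled dual point, so they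
      persist on the whole segment from the reference pair ([kkt_segment]): the
      solution map is affine along each short segment that starts at the
      reference parameter. A Lipschitz function with this property is semismooth
      ([radial_semismooth]): at a point [u] of differentiability the Jacobian maps
      [u - p] to [f u - f p], a relation that survives limits and convex
      combinations, so every Clarke Jacobian reproduces the difference quotient.

    - The difference quotient from [xb] to [x] lies in the span of [N(w)]. All of
      [N(w)] is orthogonal to [w - v], so on an orthonormal basis of that span the
      optimality conditions become the normal equations of a least-squares
      problem, which is the formula in (a) ([regular_quotient]). *)

(** * Euclidean geometry of column vectors *)

Section InnerProduct.
Context {R : realType}.

Lemma dotvE n (u v : 'cV[R]_n) : dotv u v = \sum_i u i 0 * v i 0.
Proof. by rewrite /dotv mxE; apply: eq_bigr => i _; rewrite mxE. Qed.

Lemma dotvC n (u v : 'cV[R]_n) : dotv u v = dotv v u.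
Proof. by rewrite !dotvE; apply: eq_bigr => i _; rewrite mulrC. Qed.

Lemma dotvDr n (u v w : 'cV[R]_n) : dotv u (v + w) = dotv u v + dotv u w.
Proof. by rewrite /dotv mulmxDr mxE. Qed.

Lemma dotvDl n (u v w : 'cV[R]_n) : dotv (v + w) u = dotv v u + dotv w u.
Proof. by rewrite !(dotvC _ u) dotvDr. Qed.

Lemma dotvNr n (u v : 'cV[R]_n) : dotv u (- v) = - dotv u v.
Proof. by rewrite /dotv mulmxN mxE. Qed.

Lemma dotvNl n (u v : 'cV[R]_n) : dotv (- v) u = - dotv v u.
Proof. by rewrite !(dotvC _ u) dotvNr. Qed.

Lemma dotvZr n (u v : 'cV[R]_n) a : dotv u (a *: v) = a * dotv u v.
Proof. by rewrite /dotv -scalemxAr mxE. Qed.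

Lemma dotvZl n (u v : 'cV[R]_n) a : dotv (a *: v) u = a * dotv v u.
Proof. by rewrite !(dotvC _ u) dotvZr. Qed.

Lemma dotvBr n (u v w : 'cV[R]_n) : dotv u (v - w) = dotv u v - dotv u w.
Proof. by rewrite dotvDr dotvNr. Qed.

Lemma dotvBl n (u v w : 'cV[R]_n) : dotv (v - w) u = dotv v u - dotv w u.
Proof. by rewrite dotvDl dotvNl. Qed.

Lemma dotv0 n (u : 'cV[R]_n) : dotv u 0 = 0.
Proof. by rewrite /dotv mulmx0 mxE. Qed.

Lemma dot0v n (u : 'cV[R]_n) : dotv 0 u = 0.
Proof. by rewrite dotvC dotv0. Qed.

Lemma dotv_sumr n k (u : 'cV[R]_n) (c : 'I_k -> R) (d : 'I_k -> 'cV[R]_n) :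
  dotv u (\sum_i c i *: d i) = \sum_i c i * dotv u (d i).
Proof.
rewrite (big_morph (dotv u) (dotvDr u) (dotv0 u)).
by apply: eq_bigr => i _; rewrite dotvZr.
Qed.

Lemma dotv_mulmxr n k (B : 'M[R]_(n, k)) u v :
  dotv u (B *m v) = dotv (B^T *m u) v.
Proof. by rewrite /dotv trmx_mul trmxK mulmxA. Qed.

Lemma dotv_mulmxl n k (B : 'M[R]_(n, k)) u v :
  dotv (B *m v) u = dotv v (B^T *m u).
Proof. by rewrite dotvC dotv_mulmxr dotvC. Qed.

Lemma dotv_ge0 n (u : 'cV[R]_n) : 0 <= dotv u u.
Proof. by rewrite dotvE sumr_ge0// => i _; rewrite -expr2 sqr_ge0. Qed.

Lemma dotv_eq0 n (u : 'cV[R]_n) : dotv u u = 0 -> u = 0.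
Proof.
move=> /eqP; rewrite dotvE psumr_eq0; last first.
  by move=> i _; rewrite -expr2 sqr_ge0.
move=> /allP u0; apply/colP => i; rewrite mxE.
by have := u0 i (mem_index_enum _); rewrite /= mulf_eq0 orbb => /eqP.
Qed.

Lemma enorm_ge0 n (u : 'cV[R]_n) : 0 <= enorm u.
Proof. exact: sqrtr_ge0. Qed.

Lemma sqr_enorm n (u : 'cV[R]_n) : enorm u ^+ 2 = dotv u u.
Proof. by rewrite sqr_sqrtr ?dotv_ge0. Qed.

Lemma enorm0 n : enorm (0 : 'cV[R]_n) = 0.
Proof. by rewrite /enorm dotv0 sqrtr0. Qed.

Lemma enorm_eq0 n (u : 'cV[R]_n) : enorm u = 0 -> u = 0.
Proof. by move=> u0; apply: dotv_eq0; rewrite -sqr_enorm u0 expr0n. Qed.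

Lemma enorm_gt0 n (u : 'cV[R]_n) : u != 0 -> 0 < enorm u.
Proof.
move=> u0; rewrite lt_neqAle enorm_ge0 andbT eq_sym.
by apply: contra_neq u0 => /enorm_eq0.
Qed.

Lemma enormZ n a (u : 'cV[R]_n) : enorm (a *: u) = `|a| * enorm u.
Proof.
by rewrite /enorm dotvZl dotvZr mulrA -expr2 sqrtrM ?sqr_ge0// sqrtr_sqr.
Qed.

Lemma enormN n (u : 'cV[R]_n) : enorm (- u) = enorm u.
Proof. by rewrite -scaleN1r enormZ normrN1 mul1r. Qed.

Lemma enorm_sub n (u v : 'cV[R]_n) : enorm (u - v) = enorm (v - u).
Proof. by rewrite -enormN opprB. Qed.

Lemma dotv_le_enorm n (u v : 'cV[R]_n) : dotv u v <= enorm u * enorm v.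
Proof.
have [->|u0] := eqVneq u 0; first by rewrite dot0v enorm0 mul0r.
have [->|v0] := eqVneq v 0; first by rewrite dotv0 enorm0 mulr0.
have a0 := enorm_gt0 u0; have b0 := enorm_gt0 v0.
have := dotv_ge0 (enorm v *: u - enorm u *: v).
rewrite !(dotvBl, dotvBr, dotvZl, dotvZr) (dotvC v u) -!sqr_enorm => h.
have : 0 <= (enorm u * enorm v) * (enorm u * enorm v - dotv u v) by nra.
by rewrite pmulr_rge0 ?mulr_gt0// subr_ge0.
Qed.

Lemma norm_dotv_le n (u v : 'cV[R]_n) : `|dotv u v| <= enorm u * enorm v.
Proof.
by rewrite ler_norml dotv_le_enorm andbT lerNl -dotvNl -(enormN u) dotv_le_enorm.
Qed.

Lemma enormD n (u v : 'cV[R]_n) : enorm (u + v) <= enorm u + enorm v.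
Proof.
rewrite -(@ler_pXn2r _ 2) ?nnegrE ?addr_ge0 ?enorm_ge0//.
rewrite sqr_enorm dotvDl !dotvDr (dotvC v u) sqrrD !sqr_enorm.
by have := dotv_le_enorm u v; lra.
Qed.

Lemma norm_coord_le n (u : 'cV[R]_n) i : `|u i 0| <= enorm u.
Proof.
rewrite -sqrtr_sqr ler_wsqrtr// dotvE (bigD1 i)//= -expr2 lerDl sumr_ge0//.
by move=> j _; rewrite -expr2 sqr_ge0.
Qed.

Lemma mx_norm_le_enorm n (u : 'cV[R]_n) : `|u| <= enorm u.
Proof.
rewrite [leLHS]/Num.Def.normr/= mx_normrE; apply: bigmax_le => [|[i j] _].
  exact: enorm_ge0.
by rewrite ord1 norm_coord_le.
Qed.

Lemma orthonormal_dotv n k (Q : 'M[R]_(n, k)) c d :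
  orthonormal_cols Q -> dotv (Q *m c) (Q *m d) = dotv c d.
Proof. by move=> QQ; rewrite dotv_mulmxr mulmxA QQ mul1mx. Qed.

Lemma orthonormal_enorm n k (Q : 'M[R]_(n, k)) c :
  orthonormal_cols Q -> enorm (Q *m c) = enorm c.
Proof. by move=> QQ; rewrite /enorm orthonormal_dotv. Qed.

End InnerProduct.

Section Convergence.
Context {R : realType}.

Lemma cvg_mx (T : Type) (F : set_system T) {FF : Filter F} k n
    (f : T -> 'M[R]_(k, n)) (a : 'M[R]_(k, n)) :
  (forall i j, (fun x => f x i j) @ F --> a i j) -> f @ F --> a.
Proof.
move=> h; apply/cvg_ballP => e e0.
suff : \forall x \near F, forall i j, ball (a i j) e (f x i j).
  by apply: filterS => x bx; split.
apply: filter_forall => i; apply: filter_forall => j.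
by move/cvg_ballP : (h i j); apply.
Qed.

Lemma cvg_mx_coord (T : Type) (F : set_system T) {FF : Filter F} k n
    (f : T -> 'M[R]_(k, n)) (a : 'M[R]_(k, n)) i j :
  f @ F --> a -> (fun x => f x i j) @ F --> a i j.
Proof.
move=> fa; apply: (cvg_comp f (fun M : 'M[R]_(k, n) => M i j) fa).
exact: coord_continuous.
Qed.

Lemma cvg_mulmx (T : Type) (F : set_system T) {FF : Filter F} k n p
    (f : T -> 'M[R]_(k, n)) (g : T -> 'M[R]_(n, p)) (a : 'M[R]_(k, n)) (b : 'M[R]_(n, p)) :
  f @ F --> a -> g @ F --> b -> (fun x => f x *m g x) @ F --> a *m b.
Proof.
move=> fa gb; apply: cvg_mx => i j.
under eq_fun do rewrite mxE.
rewrite mxE; apply: cvg_big => [|l _]; first exact: add_continuous.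
by apply: cvgM; exact: cvg_mx_coord.
Qed.

Lemma cvg_dotv (T : Type) (F : set_system T) {FF : Filter F} n
    (f g : T -> 'cV[R]_n) (a b : 'cV[R]_n) :
  f @ F --> a -> g @ F --> b -> (fun x => dotv (f x) (g x)) @ F --> dotv a b.
Proof.
move=> fa gb; rewrite dotvE; under eq_fun do rewrite dotvE.
apply: cvg_big => [|l _]; first exact: add_continuous.
by apply: cvgM; exact: cvg_mx_coord.
Qed.

Lemma cvg_enorm (T : Type) (F : set_system T) {FF : Filter F} n
    (f : T -> 'cV[R]_n) (a : 'cV[R]_n) :
  f @ F --> a -> (fun x => enorm (f x)) @ F --> enorm a.
Proof.
move=> fa; rewrite /enorm.
have h1 : (fun x => dotv (f x) (f x)) @ F --> dotv a a by exact: cvg_dotv.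
have h2 := @sqrt_continuous R (dotv a a).
exact: (cvg_comp (fun x => dotv (f x) (f x)) (@Num.sqrt R) h1 h2).
Qed.

Lemma cvg_pt_b (T : Type) (F : set_system T) {FF : Filter F} m
    (f : T -> 'cV[R]_(m + 1)) (p : 'cV[R]_(m + 1)) :
  f @ F --> p -> (fun t => pt_b (f t)) @ F --> pt_b p.
Proof.
move=> fp; apply: cvg_mx => i j; rewrite /pt_b; under eq_fun do rewrite mxE.
by rewrite mxE; exact: cvg_mx_coord.
Qed.

Lemma cvg_pt_lam (T : Type) (F : set_system T) {FF : Filter F} m
    (f : T -> 'cV[R]_(m + 1)) (p : 'cV[R]_(m + 1)) :
  f @ F --> p -> (fun t => pt_lam (f t)) @ F --> pt_lam p.
Proof.
move=> fp; rewrite /pt_lam; under eq_fun do rewrite mxE.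
by rewrite mxE; exact: cvg_mx_coord.
Qed.

Lemma cvg_near_lt (T : Type) (F : set_system T) {FF : Filter F}
    (f : T -> R) a c : f @ F --> a -> a < c -> \forall x \near F, f x < c.
Proof. by move=> fa ac; exact: (cvgr_lt a). Qed.

Lemma near_enorm_lt n (a : 'cV[R]_n) e :
  0 < e -> \forall x \near a, enorm (x - a) < e.
Proof.
move=> e0; have : (fun x => enorm (x - a)) @ nbhs a --> enorm (a - a).
  by apply: (cvg_enorm (F := nbhs a)); apply: (cvgB (F := nbhs a)) => //; exact: cvg_cst.
by rewrite subrr enorm0 => /cvg_near_lt; apply.
Qed.

Lemma near_enorm_ball n (a : 'cV[R]_n) (U : set 'cV[R]_n) :
  (\forall x \near a, U x) ->
  exists2 e, 0 < e & forall x, enorm (x - a) < e -> U x.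
Proof.
move=> /nbhs_ballP[e /= e0 eU]; exists e => // x xa; apply: eU.
rewrite -ball_normE /ball_/=; apply: le_lt_trans xa.
by rewrite enorm_sub mx_norm_le_enorm.
Qed.

Lemma enorm_ball_near n (a : 'cV[R]_n) e (U : set 'cV[R]_n) : 0 < e ->
  (forall x, enorm (x - a) < e -> U x) -> \forall x \near a, U x.
Proof. by move=> e0 eU; apply: filterS (near_enorm_lt a e0). Qed.

Lemma cV_bounded_closed_compact n (K : set 'cV[R]_n) (c : R) :
  (forall x, K x -> enorm x <= c) -> closed K -> compact K.
Proof.
move=> Kc Kcl.
pose tr : 'rV[R]_n -> 'cV[R]_n := trmx.
have trc : continuous tr.
  move=> x; apply: (cvg_mx (F := nbhs x)) => i j; rewrite mxE.
  under eq_fun do rewrite mxE.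
  exact: coord_continuous.
have -> : K = tr @` (tr @^-1` K).
  apply/seteqP; split=> [x Kx|_ [x /= Kx <-]//].
  by exists x^T; rewrite /= /tr ?trmxK.
apply: continuous_compact; first exact: continuous_subspaceT.
apply: bounded_closed_compact; last first.
  by apply: preimage_closed => // x _; exact: trc.
exists c; split=> [|M cM x /= /Kc]; first exact: num_real.
move=> xc; rewrite [leLHS]/Num.Def.normr/= mx_normrE.
have c0 : 0 <= c by exact: le_trans (enorm_ge0 _) xc.
apply: bigmax_le => [|[i j] _ /=]; first by lra.
by have := norm_coord_le (tr x) j; rewrite mxE (ord1 i); lra.
Qed.

End Convergence.

(** * Projections of polyhedra *)

Section Polyhedra.
Context {R : realType}.

Lemma polyhedron_finType n (J : finType) (a : J -> 'cV[R]_n) (c : J -> R) :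
  polyhedron [set z | forall j, dotv (a j) z <= c j].
Proof.
exists #|J|, (\matrix_(i, j) a (enum_val i) j 0), (\col_i c (enum_val i)).
have rowE z i : ((\matrix_(i, j) a (enum_val i) j 0) *m z) i 0
    = dotv (a (enum_val i : J)) z.
  by rewrite dotvE mxE; apply: eq_bigr => j _; rewrite mxE.
apply/seteqP; split=> z /= h => [i|j]; first by rewrite rowE mxE.
by have := h (enum_rank j); rewrite rowE mxE enum_rankK.
Qed.

Lemma mulmx_row_dotv k n (G : 'M[R]_(k, n)) z i :
  (G *m z) i 0 = dotv (row i G)^T z.
Proof. by rewrite dotvE mxE; apply: eq_bigr => j _; rewrite !mxE. Qed.

Lemma polyhedron_preimage n k (B : 'M[R]_(n, k)) (C : set 'cV[R]_n) :
  polyhedron C -> polyhedron [set z | C (B *m z)].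
Proof.
move=> [j [G [g ->]]]; exists j, (G *m B), g.
by apply/seteqP; split=> z /= h i; have := h i; rewrite mulmxA.
Qed.

Lemma polyhedronI n (C D : set 'cV[R]_n) :
  polyhedron C -> polyhedron D -> polyhedron (C `&` D).
Proof.
move=> [j [G [g ->]]] [k [H [h ->]]].
exists (j + k)%N, (col_mx G H), (col_mx g h).
apply/seteqP; split=> z /=; rewrite mul_col_mx.
  move=> [Gz Hz] i; case: (fintype.splitP i) => i' ii'.
    by rewrite (_ : i = lshift k i') ?col_mxEu//; exact: val_inj.
  by rewrite (_ : i = rshift j i') ?col_mxEd//; exact: val_inj.
move=> zi; split=> i.
  by have := zi (lshift k i); rewrite !col_mxEu.
by have := zi (rshift j i); rewrite !col_mxEd.
Qed.

(** Supplies the coordinate along the eliminated line: inequalities with negative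
    coefficient bound it from below, those with positive coefficient from above. *)
Lemma interpolate (I : finType) (lo up : pred I) (f : I -> R) :
  (forall i j, lo i -> up j -> f i <= f j) ->
  exists t, (forall i, lo i -> f i <= t) /\ (forall j, up j -> t <= f j).
Proof.
move=> lu; case: (pickP lo) => [i0 li0|lo0].
  case: (arg_maxP f li0) => i li imax.
  by exists (f i); split=> [j /imax//|j /lu]; exact.
case: (pickP up) => [j0 uj0|up0].
  case: (arg_minP f uj0) => j uj jmin.
  by exists (f j); split=> [i|i /jmin//]; rewrite lo0.
by exists 0; split=> [i|j]; rewrite ?lo0 ?up0.
Qed.

(** One step of Fourier-Motzkin elimination: the inequalities whose coefficients
    along the line have opposite signs are combined in pairs, so that the
    direction of the line disappears. *)
Lemma polyhedron_add_line n (C : set 'cV[R]_n) (e : 'cV[R]_n) :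
  polyhedron C -> polyhedron [set z | exists t, C (z + t *: e)].
Proof.
move=> [k [G [g ->]]].
pose s i : R := (G *m e) i 0.
(* the weights that cancel the coefficients [s i] and [s j]; a pair [(i, j)] with
   [s i = 0] stands for the inequality [i] alone *)
pose comb (ij : 'I_k * 'I_k) : 'cV[R]_k :=
  if s ij.1 == 0 then delta_mx ij.1 0
  else if (0 < s ij.1) && (s ij.2 < 0)
  then - s ij.2 *: delta_mx ij.1 0 + s ij.1 *: delta_mx ij.2 0 else 0.
have dE i (u : 'cV[R]_k) : dotv (delta_mx i 0) u = u i 0.
  rewrite dotvE (bigD1 i)//= mxE !eqxx mul1r big1 ?addr0// => j ji.
  by rewrite mxE (negPf ji) mul0r.
suff -> : [set z | exists t, forall i, (G *m (z + t *: e)) i 0 <= g i 0]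
  = [set z | forall ij, dotv (G^T *m comb ij) z <= dotv (comb ij) g].
  exact: polyhedron_finType.
have GE z t i : (G *m (z + t *: e)) i 0 = (G *m z) i 0 + t * s i.
  by rewrite mulmxDr mxE -scalemxAr [X in _ + X]mxE.
apply/seteqP; split=> z /=.
  move=> [t ht] ij; rewrite -dotv_mulmxr /comb.
  have := ht ij.1; have := ht ij.2; rewrite !GE => h2 h1.
  case: eqVneq => [s0|_]; first by rewrite !dE; move: h1; rewrite s0; lra.
  case: ifP => [/andP[s1 s2]|_]; last by rewrite !dot0v.
  rewrite !(dotvDl, dotvZl, dE).
  move: s1 s2 h1 h2; move: (s _) (s _) (g _ _) (g _ _) ((G *m z) _ _) ((G *m z) _ _).
  move=> b a c d x y a0 b0 h1 h2.
  have : (- b) * (y + t * a) <= (- b) * d by rewrite ler_pM2l// oppr_gt0.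
  have : a * (x + t * b) <= a * c by rewrite ler_pM2l.
  lra.
move=> hc.
pose f i := (g i 0 - (G *m z) i 0) / s i.
have [|t [tlo tup]] := @interpolate _ (fun i => s i < 0) (fun i => 0 < s i) f.
  move=> j i sj si; have := hc (i, j); rewrite -dotv_mulmxr /comb/=.
  rewrite si sj gt_eqF//= !(dotvDl, dotvZl, dE) /f.
  move: si sj; move: (s _) (s _) (g _ _) (g _ _) ((G *m z) _ _) ((G *m z) _ _).
  move=> b a c d x y b0 a0 h.
  by rewrite ler_ndivrMr// mulrAC ler_pdivrMr//; lra.
exists t => i; rewrite GE.
case: (ltgtP (s i) 0) => [si|si|si].
- by have := tlo i si; rewrite /f ler_ndivrMr//; lra.
- by have := tup i si; rewrite /f ler_pdivlMr//; lra.
- have := hc (i, i); rewrite -dotv_mulmxr /comb/= si eqxx !dE; lra.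
Qed.

Lemma polyhedron_add_range n k (C : set 'cV[R]_n) (E : 'M[R]_(n, k)) :
  polyhedron C -> polyhedron [set z | exists t, C (z + E *m t)].
Proof.
move=> pC; elim: k E => [|k IH] E.
  suff -> : [set z | exists t, C (z + E *m t)] = C by [].
  apply/seteqP; split=> z /=; first by move=> [t]; rewrite (flatmx0 t) mulmx0 addr0.
  by move=> Cz; exists 0; rewrite mulmx0 addr0.
move: (E : 'M[R]_(n, 1 + k)) => {}E; rewrite -(hsubmxK E).
suff -> : [set z | exists t, C (z + row_mx (lsubmx E) (rsubmx E) *m t)]
  = [set z | exists t, [set z | exists t, C (z + rsubmx E *m t)] (z + t *: lsubmx E)].
  exact/polyhedron_add_line/IH.
apply/seteqP; split=> z /=.
  move=> [t]; rewrite -(vsubmxK (t : 'cV[R]_(1 + k))) mul_row_col addrA => h.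
  exists (usubmx (t : 'cV[R]_(1 + k)) 0 0), (dsubmx (t : 'cV[R]_(1 + k))).
  by rewrite -mul_mx_scalar -mx11_scalar.
move=> [t0 [t h]]; exists (col_mx t0%:M t : 'cV[R]_(1 + k)).
by rewrite mul_row_col addrA mul_mx_scalar.
Qed.

(** The image is the slice at height zero of the sum of the graph and of the
    vertical space. *)
Lemma polyhedron_image n k (B : 'M[R]_(n, k)) (C : set 'cV[R]_k) :
  polyhedron C -> polyhedron [set B *m z | z in C].
Proof.
move=> pC.
pose graph := [set z : 'cV[R]_(n + k) | C (row_mx 0 1%:M *m z)]
  `&` ([set z | [set u : 'cV[R]_n | forall i, u i 0 <= 0] (row_mx 1%:M (- B) *m z)]
  `&` [set z | [set u : 'cV[R]_n | forall i, u i 0 <= 0] (row_mx (- 1%:M) B *m z)]).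
have neg : polyhedron [set u : 'cV[R]_n | forall i, u i 0 <= 0].
  by exists n, 1%:M, 0; apply/seteqP; split=> u /= h i; have := h i; rewrite mul1mx mxE.
have pG : polyhedron graph.
  by apply: polyhedronI; [|apply: polyhedronI]; exact: polyhedron_preimage.
have := polyhedron_preimage (col_mx 1%:M 0 : 'M[R]_(n + k, n))
  (polyhedron_add_range (col_mx 0 1%:M : 'M[R]_(n + k, k)) pG).
suff -> : [set z | [set z | exists t, graph (z + col_mx 0 1%:M *m t)]
   (col_mx 1%:M 0 *m z)] = [set B *m z | z in C] by [].
have graphE (y : 'cV[R]_n) t : graph (col_mx 1%:M 0 *m y + col_mx 0 1%:M *m t)
    <-> C t /\ y = B *m t.
  rewrite !mul_col_mx !mul1mx !mul0mx add_col_mx addr0 add0r /graph /=.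
  rewrite !mul_row_col !mul1mx mul0mx add0r !mulNmx mul1mx.
  split=> [[Ct [h1 h2]]|[Ct ->]]; last first.
    by rewrite subrr addNr; do 2!split=> //; move=> i; rewrite mxE.
  split=> //; apply/colP => i; have := h1 i; have := h2 i; rewrite !mxE; lra.
apply/seteqP; split=> y /=; first by move=> [t /graphE[Ct ->]]; exists t.
by move=> [t Ct <-]; exists t; apply/graphE.
Qed.

End Polyhedra.

(** * Orthonormal bases and extreme singular values *)

Section OrthonormalBasis.
Context {R : realType}.

(** Gram-Schmidt in one sweep: an orthonormal family of maximal size in [W]
    spans [W], since otherwise the normalized residual of a vector outside its
    range would enlarge it. *)
Lemma orthonormal_basis_exists n (W : set 'cV[R]_n) :
  W 0 -> (forall a u v, W u -> W v -> W (a *: u + v)) ->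
  exists k (Q : 'M[R]_(n, k)), orthonormal_basis Q W.
Proof.
move=> W0 Wlin.
pose P k := exists Q : 'M[R]_(n, k), orthonormal_cols Q /\ forall c, W (Q *m c).
have P0 : P 0%N.
  by exists 0; split=> [|c]; [rewrite /orthonormal_cols !flatmx0|rewrite mul0mx].
have Pn k : P k -> (k <= n)%N.
  move=> [Q [QQ _]]; rewrite -(mxrank1 R k) -QQ.
  by rewrite (leq_trans (mxrankM_maxr _ _))// rank_leq_row.
have exP : exists k, `[<P k>] by exists 0%N; apply/asboolP.
have [k /asboolP[Q [QQ QW]] kmax] := ex_maxnP exP (fun k => Pn k \o elimT (asboolP _)).
exists k, Q; split=> //; apply/seteqP; split=> [x Wx|_ [c ->]//].
exists (Q^T *m x); apply/eqP; rewrite -subr_eq0; apply/negP => /negP r0.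
set r := x - _ in r0; have rp := enorm_gt0 r0.
have Qr : Q^T *m r = 0 by rewrite mulmxBr (mulmxA _ Q) QQ mul1mx subrr.
pose e := (enorm r)^-1 *: r.
have Qe : Q^T *m e = 0 by rewrite -scalemxAr Qr scaler0.
have ee : e^T *m e = 1%:M.
  rewrite [LHS]mx11_scalar -/(dotv e e) /e dotvZl dotvZr -sqr_enorm.
  by congr _%:M; field; rewrite gt_eqF.
suff /asboolP /kmax : P (k + 1)%N by rewrite addn1 ltnn.
exists (row_mx Q e); split=> [|c].
  rewrite /orthonormal_cols tr_row_mx mul_col_row QQ ee Qe.
  by rewrite -[e^T *m Q]trmxK trmx_mul trmxK Qe trmx0 -scalar_mx_block.
rewrite -(vsubmxK c) mul_row_col addrC [dsubmx c]mx11_scalar mul_mx_scalar scalerA.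
have Wr : W r by rewrite /r -mulmxN -[X in X + _]scale1r; exact: (Wlin).
exact: (Wlin).
Qed.

Lemma lin_span_linear n (D : set 'cV[R]_n) a u v :
  lin_span D u -> lin_span D v -> lin_span D (a *: u + v).
Proof.
move=> [j [c [d [Dd ->]]]] [k [e [f [Df ->]]]].
exists (j + k)%N,
  (fun i => match fintype.split i with inl i => a * c i | inr i => e i end),
  (fun i => match fintype.split i with inl i => d i | inr i => f i end).
split=> [i|]; first by case: fintype.split.
rewrite big_split_ord scaler_sumr/=; congr (_ + _); apply: eq_bigr => i _.
  case: fintype.splitP => [i' /= /val_inj <-|i' /= ii']; first by rewrite scalerA.
  by have := ltn_ord i; rewrite ii' ltnNge leq_addr.
case: fintype.splitP => [i' /= ii'|i' /= /addnI /val_inj <-//].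
by have := ltn_ord i'; rewrite -ii' ltnNge leq_addr.
Qed.

Lemma lin_span0 n (D : set 'cV[R]_n) : lin_span D 0.
Proof.
by exists 0%N, (fun=> 0), (fun=> 0); split=> [[]//|]; rewrite big_ord0.
Qed.

Lemma mem_lin_span n (D : set 'cV[R]_n) x : D x -> lin_span D x.
Proof.
by move=> Dx; exists 1%N, (fun=> 1), (fun=> x); rewrite big_ord1 scale1r.
Qed.

Lemma lin_spanB n (D : set 'cV[R]_n) x y : D x -> D y -> lin_span D (x - y).
Proof.
move=> Dx Dy; rewrite addrC -scaleN1r.
by apply: lin_span_linear; exact: mem_lin_span.
Qed.

Lemma sub_lin_span n (D E : set 'cV[R]_n) : D `<=` E -> lin_span D `<=` lin_span E.
Proof. by move=> DE x [k [c [d [Dd ->]]]]; exists k, c, d; split=> // i; exact: DE. Qed.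

Lemma dotv_lin_span n (D : set 'cV[R]_n) u x :
  (forall y, D y -> dotv u y = 0) -> lin_span D x -> dotv u x = 0.
Proof.
by move=> Du [k [c [d [Dd ->]]]]; rewrite dotv_sumr big1// => i _; rewrite Du// mulr0.
Qed.

Lemma lin_span_basis n (D : set 'cV[R]_n) :
  exists k (Q : 'M[R]_(n, k)), orthonormal_basis Q (lin_span D).
Proof.
apply: orthonormal_basis_exists; first exact: lin_span0.
by move=> a u v; exact: lin_span_linear.
Qed.

End OrthonormalBasis.

Section SingularValues.
Context {R : realType}.

(** The Rayleigh quotient attains its minimum on the unit sphere, and a
    minimizer is an eigenvector: the form of [H - mu] is then nonnegative and
    vanishes at it. *)
Lemma min_eigenpair k (H : 'M[R]_k) : (0 < k)%N -> H^T = H ->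
  exists mu (c : 'cV[R]_k),
    [/\ c != 0, H *m c = mu *: c & forall d, mu * dotv d d <= dotv d (H *m d)].
Proof.
move=> k0 Hsym.
pose S := [set c : 'cV[R]_k | dotv c c = 1].
have S0 : S !=set0.
  exists (delta_mx (Ordinal k0) 0); rewrite /S/= dotvE (bigD1 (Ordinal k0))//=.
  rewrite mxE !eqxx mulr1 big1 ?addr0// => j /negPf j0.
  by rewrite mxE j0 mul0r.
have cdot (c : 'cV[R]_k) (B : 'M[R]_k) :
    (fun d : 'cV[R]_k => dotv d (B *m d)) @ nbhs c --> dotv c (B *m c).
  apply: (cvg_dotv (F := nbhs c)) => //.
  by apply: (cvg_mulmx (F := nbhs c)) => //; exact: cvg_cst.
have Scompact : compact S.
  apply: (@cV_bounded_closed_compact _ _ _ 1).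
    by move=> c cc; rewrite /enorm cc sqrtr1.
  rewrite (_ : S = (fun c : 'cV[R]_k => dotv c c) @^-1` [set 1])//.
  apply: preimage_closed; last exact: closed_eq.
  by move=> c _; have := cdot c 1%:M; under eq_fun do rewrite mul1mx; rewrite mul1mx.
have [c /set_mem cS cmin] : exists2 c, c \in S & forall d, d \in S ->
    dotv c (H *m c) <= dotv d (H *m d).
  apply: compact_EVT_min => //; apply: continuous_subspaceT => d; exact: cdot.
pose mu := dotv c (H *m c).
have c0 : c != 0 by apply: contra_eq_neq cS => ->; rewrite dotv0 eq_sym oner_eq0.
have lemu d : mu * dotv d d <= dotv d (H *m d).
  have [->|d0] := eqVneq d 0; first by rewrite mulmx0 !dotv0 mulr0.
  have dp := enorm_gt0 d0; have dE := sqr_enorm d.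
  have /mem_set /cmin : S ((enorm d)^-1 *: d).
    by rewrite /S/= dotvZl dotvZr -dE; field; rewrite gt_eqF.
  rewrite -scalemxAr dotvZl dotvZr -/mu mulrA -expr2 exprVn mulrC.
  by rewrite ler_pdivlMr ?exprn_gt0// dE.
exists mu, c; split=> //.
apply/eqP; rewrite -subr_eq0; apply/eqP/dotv_eq0.
have [d dE] : exists d, d = H *m c - mu *: c by eexists.
rewrite -dE.
have quad t :
    0 <= 2 * t * dotv d d + t ^+ 2 * (dotv d (H *m d) - mu * dotv d d).
  have := lemu (c + t *: d); rewrite mulmxDr -scalemxAr.
  rewrite !(dotvDl, dotvDr, dotvZl, dotvZr) -/mu cS.
  have -> : dotv c (H *m d) = dotv d (H *m c) by rewrite dotv_mulmxr Hsym dotvC.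
  rewrite (dotvC c d).
  have -> : dotv d d = dotv d (H *m c) - mu * dotv d c.
    by rewrite {2}dE dotvBr dotvZr.
  move: (dotv d (H *m c)) (dotv d c) (dotv d (H *m d)) => x y z; nra.
have := dotv_ge0 d; rewrite le_eqVlt => /orP[/eqP//|dp].
(* for this step length against [d] the linear term outweighs the quadratic one *)
pose K := dotv d (H *m d) - mu * dotv d d.
have Kp : 0 < `|K| + dotv d d by rewrite ltr_wpDl.
have := quad (- (dotv d d / (`|K| + dotv d d))); rewrite -/K.
have Kle : K <= `|K| by rewrite ler_norm.
set a := dotv d d in dp Kp *; set t := a / _.
have t0 : 0 < t by rewrite divr_gt0.
have tK : t * (`|K| + a) = a by rewrite /t mulfVK// gt_eqF.
have : t ^+ 2 * K <= t * a.
  rewrite expr2 -mulrA ler_pM2l//; rewrite -[leRHS]tK ler_pM2l//; lra.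
by nra.
Qed.

Lemma singular_valueP m k (B : 'M[R]_(m, k)) s :
  singular_value B s <->
  0 <= s /\ exists2 c : 'cV[R]_k, c != 0 & B^T *m B *m c = s ^+ 2 *: c.
Proof.
split=> -[s0 h]; split=> //.
  have /eigenvalueP[c cB c0] := h; exists c^T.
    by apply: contra_neq c0 => c0; rewrite -(trmxK c) c0 trmx0.
  by apply: trmx_inj; rewrite trmx_mul !trmxK trmx_mul trmxK cB linearZ/= trmxK.
have [c c0 cB] := h; apply/eigenvalueP; exists c^T.
  by apply: trmx_inj; rewrite trmx_mul !trmxK trmx_mul trmxK cB linearZ/= trmxK.
by apply: contra_neq c0 => c0; rewrite -(trmxK c) c0 trmx0.
Qed.

Lemma sigma_max_ge0 m k (B : 'M[R]_(m, k)) : 0 <= sigma_max B.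
Proof.
rewrite /sigma_max.
have [hs|/sup_out ->//] := pselect (has_sup (singular_value B)).
have [[s sB] _] := hs; apply: le_trans (sup_upper_bound hs sB).
by have [] := sB.
Qed.

Lemma gram_sym m k (B : 'M[R]_(m, k)) : (B^T *m B)^T = B^T *m B.
Proof. by rewrite trmx_mul trmxK. Qed.

Lemma dotv_gram m k (B : 'M[R]_(m, k)) c d :
  dotv c (B^T *m B *m d) = dotv (B *m c) (B *m d).
Proof. by rewrite -mulmxA dotv_mulmxr trmxK. Qed.

(** The infimum of the singular values is the square root of the smallest Rayleigh
    quotient of [B^T B]. *)
Lemma sigma_min_attained m k (B : 'M[R]_(m, k)) : (0 < k)%N ->
  exists c : 'cV[R]_k, [/\ c != 0,
    dotv (B *m c) (B *m c) = sigma_min B ^+ 2 * dotv c c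
    & forall d, sigma_min B ^+ 2 * dotv d d <= dotv (B *m d) (B *m d)].
Proof.
move=> k0; have [mu [c [c0 Hc mumin]]] := min_eigenpair k0 (gram_sym B).
have cc : 0 < dotv c c by rewrite -sqr_enorm exprn_gt0// enorm_gt0.
have muE : dotv (B *m c) (B *m c) = mu * dotv c c by rewrite -dotv_gram Hc dotvZr.
have mu0 : 0 <= mu by rewrite -(pmulr_lge0 _ cc) -muE dotv_ge0.
have sv : singular_value B (Num.sqrt mu).
  by apply/singular_valueP; split; [exact: sqrtr_ge0|exists c => //; rewrite sqr_sqrtr].
have lbd s : singular_value B s -> Num.sqrt mu <= s.
  move=> /singular_valueP[s0 [d d0 Hd]].
  rewrite -(ger0_norm s0) -sqrtr_sqr ler_wsqrtr//.
  have := mumin d; rewrite Hd dotvZr ler_pM2r// -sqr_enorm exprn_gt0//.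
  exact: enorm_gt0.
have -> : sigma_min B = Num.sqrt mu.
  apply/eqP; rewrite eq_le; apply/andP; split.
    by apply: ge_inf => //; exists (Num.sqrt mu).
  by apply: lb_le_inf; [exists (Num.sqrt mu)|].
rewrite sqr_sqrtr//; exists c; split=> // d; rewrite -dotv_gram; exact: mumin.
Qed.

Lemma sigma_min_ineq m k (B : 'M[R]_(m, k)) (c : 'cV[R]_k) :
  sigma_min B ^+ 2 * dotv c c <= dotv (B *m c) (B *m c).
Proof.
case: k B c => [|k] B c; first by rewrite (flatmx0 c) dotv0 mulr0 dotv_ge0.
by have [_ [_ _]] := sigma_min_attained B (ltn0Sn k); apply.
Qed.

Lemma sigma_min_sqr_gt0 m k (B : 'M[R]_(m, k)) : (0 < k)%N ->
  (forall c : 'cV[R]_k, B *m c = 0 -> c = 0) -> 0 < sigma_min B ^+ 2.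
Proof.
move=> k0 Binj; have [c [c0 Bc _]] := sigma_min_attained B k0.
have cc : 0 < dotv c c by rewrite -sqr_enorm exprn_gt0// enorm_gt0.
rewrite -(pmulr_lgt0 _ cc) -Bc -sqr_enorm exprn_gt0// enorm_gt0//.
by apply: contra_neq c0; exact: Binj.
Qed.

Lemma sigma_max_ineq m k (B : 'M[R]_(m, k)) (c : 'cV[R]_k) :
  enorm (B *m c) <= sigma_max B * enorm c.
Proof.
have [k0|k0] := posnP k.
  by subst k; rewrite (flatmx0 c) mulmx0 !enorm0 mulr0.
have Hsym : (- (B^T *m B))^T = - (B^T *m B) by rewrite linearN/= gram_sym.
have [nu [c1 [c10 Hc numin]]] := min_eigenpair k0 Hsym.
pose mu := - nu.
have {}Hc : B^T *m B *m c1 = mu *: c1 by rewrite scaleNr -Hc mulNmx opprK.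
have mumax d : dotv (B *m d) (B *m d) <= mu * dotv d d.
  by have := numin d; rewrite mulNmx dotvNr dotv_gram mulNr lerNr.
have cc : 0 < dotv c1 c1 by rewrite -sqr_enorm exprn_gt0// enorm_gt0.
have muE : dotv (B *m c1) (B *m c1) = mu * dotv c1 c1 by rewrite -dotv_gram Hc dotvZr.
have mu0 : 0 <= mu by rewrite -(pmulr_lge0 _ cc) -muE dotv_ge0.
have sv : singular_value B (Num.sqrt mu).
  by apply/singular_valueP; split; [exact: sqrtr_ge0|exists c1 => //; rewrite sqr_sqrtr].
have ubd : ubound (singular_value B) (Num.sqrt mu).
  move=> s /singular_valueP[s0 [d d0 Hd]].
  rewrite -(ger0_norm s0) -sqrtr_sqr ler_wsqrtr//.
  have := mumax d; rewrite -dotv_gram Hd dotvZr ler_pM2r// -sqr_enorm exprn_gt0//.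
  exact: enorm_gt0.
apply: (@le_trans _ _ (Num.sqrt mu * enorm c)).
  by rewrite /enorm -sqrtrM// ler_wsqrtr.
rewrite ler_wpM2r ?enorm_ge0//.
by apply: sup_upper_bound => //; split; exists (Num.sqrt mu).
Qed.

End SingularValues.

(** * Normal cones to a polyhedron near a reference point *)

Section NormalCones.
Context {R : realType}.

Lemma polyhedron_convex n (C : set 'cV[R]_n) x y s :
  polyhedron C -> C x -> C y -> 0 <= s <= 1 -> C ((1 - s) *: x + s *: y).
Proof.
move=> [k [G [g ->]]] /= Gx Gy /andP[s0 s1] i.
rewrite mulmxDr -!scalemxAr 2!mxE [X in _ + X]mxE.
by have := Gx i; have := Gy i; nra.
Qed.

Lemma normal_cone_convex n (C : set 'cV[R]_n) w u u' s :
  normal_cone C w u -> normal_cone C w u' -> 0 <= s <= 1 ->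
  normal_cone C w ((1 - s) *: u + s *: u').
Proof.
move=> [Cw h] [_ h'] /andP[s0 s1]; split=> // z Cz.
by rewrite dotvDl !dotvZl; have := h z Cz; have := h' z Cz; nra.
Qed.

Lemma normal_cone_base_convex n (C : set 'cV[R]_n) v w u s :
  polyhedron C -> normal_cone C v u -> normal_cone C w u -> 0 <= s <= 1 ->
  normal_cone C ((1 - s) *: v + s *: w) u.
Proof.
move=> pC [Cv hv] [Cw hw] s01; split=> [|z Cz]; first exact: polyhedron_convex.
have {s01} /andP[s0 s1] := s01.
have -> : z - ((1 - s) *: v + s *: w) = (1 - s) *: (z - v) + s *: (z - w).
  by apply/colP => i; rewrite !mxE; ring.
by rewrite dotvDr !dotvZr; have := hv z Cz; have := hw z Cz; nra.
Qed.

(** A common normal vector takes its maximum over [C] at both points. *)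
Lemma normal_cone_orth n (C : set 'cV[R]_n) v w u :
  normal_cone C v u -> normal_cone C w u -> dotv u w = dotv u v.
Proof.
move=> [Cv hv] [Cw hw]; have := hv w Cw; have := hw v Cv.
rewrite !dotvBr; lra.
Qed.

Lemma normal_cone_monotone n (C : set 'cV[R]_n) w1 w2 u1 u2 :
  normal_cone C w1 u1 -> normal_cone C w2 u2 -> 0 <= dotv (u1 - u2) (w1 - w2).
Proof.
move=> [C1 h1] [C2 h2]; have := h1 _ C2; have := h2 _ C1.
rewrite dotvBl !dotvBr; lra.
Qed.

Definition active k n (G : 'M[R]_(k, n)) (g : 'cV[R]_k) (w : 'cV[R]_n) : {set 'I_k} :=
  [set i | (G *m w) i 0 == g i 0].

(** The cone generated by the rows of [G] in [I], described as a polar so that it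
    is closed by construction. *)
Definition face_cone k n (G : 'M[R]_(k, n)) (I : {set 'I_k}) : set 'cV[R]_n :=
  [set u | forall d, (forall i, i \in I -> (G *m d) i 0 <= 0) -> dotv u d <= 0].

(** A direction allowed by the active rows stays inside the polyhedron for a short
    step, so the inactive rows do not restrict the normal cone. *)
Lemma normal_cone_active k n (G : 'M[R]_(k, n)) (g : 'cV[R]_k) w u :
  let C := [set z | forall i, (G *m z) i 0 <= g i 0] in
  C w -> (normal_cone C w u <-> face_cone G (active G g w) u).
Proof.
move=> C Cw; split; last first.
  move=> h; split=> // z Cz; apply: h => i; rewrite inE => /eqP wi.
  by rewrite mulmxBr [leLHS]mxE [X in _ + X]mxE wi subr_le0; exact: Cz.
move=> [_ h] d hd.
have [t t0 ht] : exists2 t, 0 < t & C (w + t *: d).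
  (* any step below every ratio slack / (1 + rate) keeps all inequalities *)
  pose f i := if i \in active G g w then 1
    else (g i 0 - (G *m w) i 0) / (1 + `|(G *m d) i 0|).
  have fp i : 0 < f i.
    rewrite /f; case: ifPn => [//|]; rewrite inE => wi.
    apply: divr_gt0; last by rewrite ltr_wpDr.
    by rewrite subr_gt0 lt_neqAle wi; exact: Cw.
  have [t [t0 tf]] : exists t, 0 < t /\ forall i, t <= f i.
    exists (\big[Num.min/1]_i f i); split; last by move=> i; exact: bigmin_le_cond.
    by apply: lt_bigmin => //= i _.
  exists t => // i; rewrite mulmxDr mxE -scalemxAr [X in _ + X]mxE.
  have := tf i; rewrite /f; case: ifPn => [wi _|wi].
    have := hd _ wi; move: wi; rewrite inE => /eqP ->; nra.
  have Dp : 0 < 1 + `|(G *m d) i 0| by rewrite ltr_wpDr.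
  rewrite ler_pdivlMr// => ht; have := ler_norm ((G *m d) i 0); nra.
have := h _ ht; rewrite addrAC subrr add0r dotvZr.
by rewrite pmulr_rle0.
Qed.

(** Near a reference pair [(x, v)], the active set of [w] is contained in that
    of [v], and only those of the finitely many closed cones [face_cone G I]
    that contain [x] matter. *)
Lemma normal_cone_near n (C : set 'cV[R]_n) v x :
  polyhedron C -> C v ->
  \forall z \near x & w \near v, normal_cone C w z ->
    normal_cone C w `<=` normal_cone C v /\ normal_cone C w x.
Proof.
move=> [k [G [g ->]]] Cv.
have nearv : \forall w \near nbhs v, active G g w \subset active G g v.
  suff : \forall w \near nbhs v, forall i, i \in active G g w -> i \in active G g v.
    by apply: filterS => w sub; apply/fintype.subsetP.
  apply: filter_forall => i; rewrite [i \in active G g v]inE.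
  case: eqVneq => [_|vi]; first exact: nearW.
  have lt : (G *m v) i 0 < g i 0 by rewrite lt_neqAle vi; exact: Cv.
  have : (fun w => (G *m w) i 0) @ nbhs v --> (G *m v) i 0.
    apply: (cvg_mx_coord (F := nbhs v)); apply: (cvg_mulmx (F := nbhs v)) => //.
    exact: cvg_cst.
  move=> /cvg_near_lt/(_ lt); apply: filterS => w.
  by rewrite inE => /lt_eqF ->.
have nearx : \forall z \near nbhs x, forall I, face_cone G I z -> face_cone G I x.
  apply: filter_forall => I.
  have [hx|] := pselect (face_cone G I x); first exact: nearW.
  move=> /existsNP[d /not_implyP[hd /negP]]; rewrite -ltNge => xd.
  have : (fun z => - dotv z d) @ nbhs x --> - dotv x d.
    apply: cvgN; apply: (cvg_dotv (F := nbhs x)) => //; exact: cvg_cst.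
  rewrite -oppr_lt0 in xd.
  move=> /cvg_near_lt/(_ xd); apply: filterS => z.
  by rewrite oppr_lt0 ltNge => /negP zd hz; exfalso; apply: zd; exact: hz.
near=> z w => -[Cw hz].
have wv : active G g w \subset active G g v by near: w.
have zx I : face_cone G I z -> face_cone G I x by move: I; near: z.
have mono u : face_cone G (active G g w) u -> face_cone G (active G g v) u.
  by move=> hu d hd; apply: hu => i /(fintype.subsetP wv); exact: hd.
split=> [u /(normal_cone_active u Cw) /mono hu|].
  exact/(normal_cone_active u Cv).
apply/(normal_cone_active x Cw)/zx/(normal_cone_active z Cw).
by split.
Unshelve. all: by end_near. Qed.

End NormalCones.

(** * Optimality conditions *)

Section Optimality.
Context {R : realType}.
Variables (m n : nat) (A : 'M[R]_(m, n)).
Implicit Types (C : set 'cV[R]_n) (b : 'cV[R]_m) (x w : 'cV[R]_n) (lam rho : R).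

(** The epigraph of the support function of [C]. Minimizing over it keeps all
    values real, although the support function may be infinite. *)
Definition support_bound C x rho := forall y, C y -> dotv x y <= rho.

Definition quad_loss b x : R := 2^-1 * enorm (A *m x - b) ^+ 2.

Definition cost b lam x rho : R := quad_loss b x + lam * rho.

Definition minimizer C b lam x := exists rho, support_bound C x rho /\
  forall x' rho', support_bound C x' rho' -> cost b lam x rho <= cost b lam x' rho'.

Definition dual_point b lam x : 'cV[R]_n := lam^-1 *: (A^T *m (b - A *m x)).

Lemma support_bound_convex C x1 r1 x2 r2 s :
  support_bound C x1 r1 -> support_bound C x2 r2 -> 0 <= s <= 1 ->
  support_bound C (x1 + s *: (x2 - x1)) (r1 + s * (r2 - r1)).
Proof.
move=> h1 h2 /andP[s0 s1] y Cy; have := h1 y Cy; have := h2 y Cy.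
by rewrite dotvDl dotvZl dotvBl; nra.
Qed.

Lemma quad_lossD b x d :
  quad_loss b (x + d) = quad_loss b x - dotv (A^T *m (b - A *m x)) d
    + 2^-1 * dotv (A *m d) (A *m d).
Proof.
rewrite /quad_loss !sqr_enorm mulmxDr addrAC.
rewrite -dotv_mulmxr -[b - _]opprB dotvNl !(dotvDl, dotvDr) !(dotvNl, dotvNr).
rewrite !(dotvC _ (A *m d)); lra.
Qed.

Lemma quad_loss_convex b x1 x2 s : 0 <= s <= 1 ->
  quad_loss b (x1 + s *: (x2 - x1)) <=
    quad_loss b x1 + s * (quad_loss b x2 - quad_loss b x1).
Proof.
move=> /andP[s0 s1].
have -> : quad_loss b x2 = quad_loss b (x1 + (x2 - x1)) by rewrite subrKC.
rewrite !quad_lossD -!scalemxAr !(dotvZl, dotvZr).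
have /(mulr_ge0 (mulr_ge0 s0 (_ : 0 <= 1 - s))) := dotv_ge0 (A *m (x2 - x1)).
by rewrite subr_ge0 => /(_ s1); lra.
Qed.

Lemma cost_convex b lam x1 r1 x2 r2 s : 0 <= s <= 1 ->
  cost b lam (x1 + s *: (x2 - x1)) (r1 + s * (r2 - r1)) <=
    cost b lam x1 r1 + s * (cost b lam x2 r2 - cost b lam x1 r1).
Proof. by move=> s01; rewrite /cost; have := quad_loss_convex b x1 x2 s01; lra. Qed.

Lemma ge0_of_small (a c : R) :
  (forall t, 0 < t <= 1 -> 0 <= a + t * c) -> 0 <= a.
Proof.
move=> h; rewrite leNgt; apply/negP => a0.
have [c0|c0] := lerP c 0; first by have := h 1; rewrite ltr01 lexx => /(_ isT); lra.
have ac : 0 < c - a by lra.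
have := h (- a / (c - a)).
rewrite divr_gt0 ?oppr_gt0// ler_pdivrMr//.
have -> : a + - a / (c - a) * c = - (a ^+ 2 / (c - a)) by field; rewrite gt_eqF.
rewrite oppr_ge0 => h1; have {}h1 : a ^+ 2 / (c - a) <= 0 by apply: h1; lra.
by move: h1; rewrite leNgt divr_gt0// exprn_even_gt0//= lt_eqF.
Qed.

(** Moving from a minimizer towards any point of the epigraph does not decrease
    the cost to first order. *)
Lemma minimizer_variation b lam C x rho x' rho' :
  support_bound C x rho ->
  (forall x' rho', support_bound C x' rho' -> cost b lam x rho <= cost b lam x' rho') ->
  support_bound C x' rho' ->
  dotv (A^T *m (b - A *m x)) (x' - x) <= lam * (rho' - rho).
Proof.
move=> hx xmin hx'; rewrite -subr_ge0.
apply: (@ge0_of_small _ (2^-1 * dotv (A *m (x' - x)) (A *m (x' - x)))) => t /andP[t0 t1].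
have /xmin : support_bound C (x + t *: (x' - x)) (rho + t * (rho' - rho)).
  by apply: support_bound_convex; rewrite // (ltW t0).
rewrite /cost quad_lossD -!scalemxAr !(dotvZl, dotvZr) => h.
by rewrite -(pmulr_rge0 _ t0); lra.
Qed.

(** The optimality condition of Fermat. Homogeneity of the epigraph turns the
    variational inequality into [dotv w x' <= rho'] for all its points, with
    equality at the minimizer; testing it at the rows of an inequality system
    for [C] puts the dual point [w] into [C]. *)
Lemma minimizerP C b lam x : polyhedron C -> C !=set0 -> 0 < lam ->
  minimizer C b lam x <-> normal_cone C (dual_point b lam x) x.
Proof.
move=> pC [y0 Cy0] lam0; set w := dual_point b lam x.
have wE z : dotv (A^T *m (b - A *m x)) z = lam * dotv w z.
  by rewrite /w /dual_point dotvZl mulrA divff ?gt_eqF// mul1r.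
split; last first.
  move=> [Cw hx]; exists (dotv x w); split=> [y Cy|x' rho' hx'].
    by have := hx y Cy; rewrite dotvBr; lra.
  rewrite /cost -[in leRHS](subrKC x x') quad_lossD wE dotvBr.
  have := dotv_ge0 (A *m (x' - x)).
  have : lam * dotv w x' <= lam * rho' by rewrite ler_pM2l// dotvC; exact: hx'.
  by rewrite (dotvC x w); lra.
move=> [rho [hx xmin]].
have var x' rho' : support_bound C x' rho' -> dotv w (x' - x) <= rho' - rho.
  by move=> /(minimizer_variation hx xmin); rewrite wE ler_pM2l.
have rhoE : rho = dotv w x.
  apply/eqP; rewrite eq_le; apply/andP; split.
    have /var : support_bound C 0 0 by move=> y _; rewrite dot0v.
    by rewrite dotvBr dotv0; lra.
  have /var : support_bound C (x + x) (rho + rho).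
    by move=> y Cy; rewrite dotvDl lerD ?hx.
  by rewrite addrK addrK.
have {}var x' rho' : support_bound C x' rho' -> dotv w x' <= rho'.
  by move=> /var; rewrite rhoE dotvBr; lra.
have Cw : C w.
  have [k [G [g CE]]] := pC; rewrite CE => i.
  rewrite mulmx_row_dotv dotvC; apply: var => y.
  by rewrite CE -mulmx_row_dotv; apply.
by split=> // z Cz; rewrite dotvBr subr_le0 (dotvC x w) -rhoE; exact: hx.
Qed.

End Optimality.

Section SolutionMap.
Context {R : realType}.
Variables (m n l : nat) (A : 'M[R]_(m, n)) (P : set 'cV[R]_l) (M : 'M[R]_(l, n)).
Hypothesis P0 : P !=set0.

Let C : set 'cV[R]_n := [set M^T *m y | y in P].

Lemma support_fun_le x rho :
  (support_fun P (M *m x) <= rho%:E)%E <-> support_bound C x rho.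
Proof.
split=> [h _ [y Py <-]|h].
  rewrite -dotv_mulmxl -lee_fin; apply: le_trans h.
  by apply: ereal_sup_ubound; exists y.
apply: ge_ereal_sup => _ [y Py <-]; rewrite lee_fin dotv_mulmxl.
by apply: h; exists y.
Qed.

Lemma support_fun_neqNy x : support_fun P (M *m x) <> -oo%E.
Proof.
have [y Py] := P0; move=> supE.
suff : ((dotv (M *m x) y)%:E <= -oo)%E by rewrite leeNy_eq.
by rewrite -supE; apply: ereal_sup_ubound; exists y.
Qed.

Lemma objective_le b lam x rho : 0 < lam -> support_bound C x rho ->
  (objective A P M b lam x <= (cost A b lam x rho)%:E)%E.
Proof.
move=> lam0 /support_fun_le h; rewrite /objective /cost EFinD [X in (_ <= _ + X)%E]EFinM.
by apply: leeD => //; apply: lee_wpmul2l => //; rewrite lee_fin ltW.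
Qed.

Lemma sol_mapE p x :
  sol_map A P M p x <-> 0 < pt_lam p /\ minimizer A C (pt_b p) (pt_lam p) x.
Proof.
split=> -[lam0 h]; split=> //.
  case E : (support_fun P (M *m x)) => [rho||].
  - exists rho; split; first by apply/support_fun_le; rewrite E.
    move=> x' rho' hx'; rewrite -lee_fin.
    apply: le_trans (objective_le _ lam0 hx'); apply: le_trans (h x').
    by rewrite /objective E.
  - have h0 : support_bound C 0 0 by move=> y _; rewrite dot0v.
    have := le_trans (h 0) (objective_le (pt_b p) lam0 h0).
    by rewrite /objective E gt0_muley ?lte_fin// addey.
  - by case: (@support_fun_neqNy x).
have [rho [hx xmin]] := h => x'.
apply: le_trans (objective_le _ lam0 hx) _.
case E : (support_fun P (M *m x')) => [rho'||].
- rewrite /objective E -EFinM -EFinD lee_fin; apply: (xmin).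
  by apply/support_fun_le; rewrite E.
- by rewrite /objective E gt0_muley ?lte_fin// addey// leey.
- by case: (@support_fun_neqNy x').
Qed.

End SolutionMap.

(** * Existence and localization of solutions *)

Section Existence.
Context {R : realType}.
Variables (m n : nat) (A : 'M[R]_(m, n)) (C : set 'cV[R]_n).
Hypothesis C0 : C !=set0.

Lemma closed_support_bound :
  closed [set z : 'cV[R]_n * R | support_bound C z.1 z.2].
Proof.
have -> : [set z : 'cV[R]_n * R | support_bound C z.1 z.2] =
    \bigcap_(y in C) ((fun z : 'cV[R]_n * R => dotv z.1 y - z.2) @^-1` [set r | r <= 0]).
  by apply/seteqP; split=> z /= h y Cy; have := h y Cy; rewrite /= subr_le0.
apply: closed_bigI => y _; apply: preimage_closed; last exact: closed_le.
move=> z _; apply: (cvgB (F := nbhs z)); last exact: cvg_snd.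
apply: (cvg_dotv (F := nbhs z)); [exact: cvg_fst|exact: cvg_cst].
Qed.

Lemma cost_continuous b lam :
  continuous (fun z : 'cV[R]_n * R => cost A b lam z.1 z.2).
Proof.
move=> z; rewrite /cost /quad_loss.
apply: (cvgD (F := nbhs z)); last first.
  by apply: (cvgM (F := nbhs z)); [exact: cvg_cst|exact: cvg_snd].
apply: (cvgM (F := nbhs z)); first exact: cvg_cst.
under eq_fun do rewrite sqr_enorm.
rewrite sqr_enorm.
have h : (fun z : 'cV[R]_n * R => A *m z.1 - b) @ nbhs z --> A *m z.1 - b.
  apply: (cvgB (F := nbhs z)); last exact: cvg_cst.
  by apply: (cvg_mulmx (F := nbhs z)); [exact: cvg_cst|exact: cvg_fst].
exact: (cvg_dotv (F := nbhs z)).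
Qed.

Lemma quad_loss_ge0 b x : 0 <= quad_loss A b x.
Proof. by rewrite mulr_ge0// sqr_ge0. Qed.

(** Only heights in a bounded interval matter: below it the epigraph is empty over
    [K], above it the cost exceeds that of the given point. *)
Lemma cost_min_on_compact b lam (K : set 'cV[R]_n) (c : R) x0 rho0 :
  0 < lam -> (forall x, K x -> enorm x <= c) -> closed K ->
  K x0 -> support_bound C x0 rho0 ->
  exists x rho, [/\ K x, support_bound C x rho
    & forall x' rho', K x' -> support_bound C x' rho' ->
        cost A b lam x rho <= cost A b lam x' rho'].
Proof.
move=> lam0 Kc Kcl Kx0 h0; have [y0 Cy0] := C0.
pose c0 := cost A b lam x0 rho0.
pose T := (K `*` `[- (c * enorm y0), c0 / lam]%classic) `&`
  [set z : 'cV[R]_n * R | support_bound C z.1 z.2].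
have inT x rho : K x -> support_bound C x rho -> rho <= c0 / lam -> T (x, rho).
  move=> Kx h hc; split=> //; split=> //=; rewrite in_itv/= hc andbT.
  apply: le_trans (h _ Cy0); rewrite lerNl.
  apply: le_trans (ler_norm _) _; rewrite normrN.
  by apply: le_trans (norm_dotv_le _ _) _; rewrite ler_wpM2r ?enorm_ge0// Kc.
have T0 : T (x0, rho0).
  apply: inT => //; rewrite ler_pdivlMr// mulrC /c0 /cost lerDr.
  exact: quad_loss_ge0.
have cT : compact T.
  apply: compact_closedI; last exact: closed_support_bound.
  apply: compact_setX; last exact: segment_compact.
  exact: cV_bounded_closed_compact Kc Kcl.
have [|[x rho] /set_mem[[/= Kx _] hx] xmin] := compact_EVT_min _ cT
    (continuous_subspaceT (@cost_continuous b lam)).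
  by exists (x0, rho0).
exists x, rho; split=> // x' rho' Kx' hx'.
have [le|gt] := lerP rho' (c0 / lam).
  by apply: (xmin (x', rho')); apply/mem_set/inT.
apply: le_trans (xmin _ (mem_set T0)) _; rewrite /= -/c0.
move: gt; rewrite ltr_pdivrMr// mulrC => /ltW; rewrite /cost.
have := quad_loss_ge0 b x'; lra.
Qed.

(** A unique minimizer is stable: on a small sphere around it the cost exceeds the
    minimum by some [delta], which survives small perturbations of the data. By
    convexity the perturbed cost then exceeds its value at the center on and
    outside of the sphere, so its minimum over the ball is global. *)
Lemma minimizer_stable (p : 'cV[R]_(m + 1)) x eps : 0 < pt_lam p ->
  minimizer A C (pt_b p) (pt_lam p) x ->
  (forall x', minimizer A C (pt_b p) (pt_lam p) x' -> x' = x) -> 0 < eps ->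
  \forall p' \near p, [/\ 0 < pt_lam p',
    exists x', minimizer A C (pt_b p') (pt_lam p') x'
    & forall x', minimizer A C (pt_b p') (pt_lam p') x' -> enorm (x' - x) < eps].
Proof.
set b := pt_b p; set lam := pt_lam p => lam0 [rho [hx xmin]] xuniq eps0.
have cball : continuous (fun z : 'cV[R]_n => enorm (z - x)).
  move=> z; apply: (cvg_enorm (F := nbhs z)); apply: (cvgB (F := nbhs z)) => //.
  exact: cvg_cst.
have bound z : enorm (z - x) <= eps -> enorm z <= eps + enorm x.
  by move=> h; rewrite -[z](subrK x); apply: le_trans (enormD _ _) _; rewrite lerD2r.
have [delta delta0 sphere] : exists2 delta, 0 < delta & forall z r,
    enorm (z - x) = eps -> support_bound C z r ->
    cost A b lam x rho + delta <= cost A b lam z r.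
  have [[[z0 r0] /= [z0S z0C]]|none] := pselect (exists z : 'cV[R]_n * R,
      enorm (z.1 - x) = eps /\ support_bound C z.1 z.2); last first.
    by exists 1 => // z r zS zC; exfalso; apply: none; exists (z, r).
  have Sb z : enorm (z - x) = eps -> enorm z <= eps + enorm x.
    by move=> zS; apply: bound; rewrite zS.
  have Scl : closed [set z | enorm (z - x) = eps].
    rewrite (_ : [set _ | _] = (fun z => enorm (z - x)) @^-1` [set eps])//.
    by apply: preimage_closed => [z _|]; [exact: cball|exact: closed_eq].
  have [z [r [zS zC zmin]]] := cost_min_on_compact b lam0 Sb Scl z0S z0C.
  exists (cost A b lam z r - cost A b lam x rho).
    rewrite subr_gt0 ltNge; apply/negP => le.
    have /xuniq zx : minimizer A C b lam z.
      by exists r; split=> // x' r' /xmin; exact: le_trans.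
    by move: zS => /=; rewrite zx subrr enorm0 => /eqP; rewrite lt_eqF.
  by move=> z' r' z'S z'C; rewrite subrKC; exact: zmin.
(* [alpha] bounds the norm of [A (z - x)] on the sphere, and [beta] the variation of
   the squared norm of [A z] there *)
pose alpha := sigma_max A * eps.
pose beta := alpha ^+ 2 + 2 * enorm (A *m x) * alpha.
(* after scaling by [kap] the two costs have the same weight on the support
   function, whose values may be unbounded, and differ by their losses only *)
pose kap (p' : 'cV[R]_(m + 1)) := pt_lam p' / lam.
have kapp : kap p = 1 by rewrite /kap divff ?gt_eqF.
have lamc : pt_lam p' @[p' --> nbhs p] --> lam by exact: cvg_pt_lam.
have bc : pt_b p' @[p' --> nbhs p] --> b by exact: cvg_pt_b.
have kapc : kap p' @[p' --> nbhs p] --> (1 : R).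
  by rewrite -kapp; apply: (cvgM (F := nbhs p)) => //; exact: cvg_cst.
have small : \forall p' \near p,
    2^-1 * (`|1 - kap p'| * beta) + enorm (pt_b p' - kap p' *: b) * alpha
      - kap p' * delta < 0.
  have lim : (fun p' => 2^-1 * (`|1 - kap p'| * beta)
      + enorm (pt_b p' - kap p' *: b) * alpha - kap p' * delta) @ nbhs p -->
      2^-1 * (`|1 - 1| * beta) + enorm (b - (1 : R) *: b) * alpha - 1 * delta.
    apply: (cvgB (F := nbhs p)); last first.
      by apply: (cvgM (F := nbhs p)) => //; exact: cvg_cst.
    apply: (cvgD (F := nbhs p)).
      apply: (cvgM (F := nbhs p)); first exact: cvg_cst.
      apply: (cvgM (F := nbhs p)); last exact: cvg_cst.
      apply: (cvg_norm (F := nbhs p)); apply: (cvgB (F := nbhs p)) => //.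
      exact: cvg_cst.
    apply: (cvgM (F := nbhs p)); last exact: cvg_cst.
    apply: (cvg_enorm (F := nbhs p)); apply: (cvgB (F := nbhs p)) => //.
    by apply: (cvgZ (F := nbhs p)) => //; exact: cvg_cst.
  apply: (cvg_near_lt lim).
  by rewrite subrr normr0 scale1r subrr enorm0 !mul0r mulr0 mul1r add0r sub0r oppr_lt0.
have lamp : \forall p' \near p, 0 < pt_lam p'.
  have : - pt_lam p' @[p' --> nbhs p] --> - lam by exact: (cvgN (F := nbhs p)).
  have lamN : - lam < 0 by rewrite oppr_lt0.
  by move=> /cvg_near_lt /(_ lamN); apply: filterS => q; rewrite oppr_lt0.
near=> p'.
have lam'0 : 0 < pt_lam p' by near: p'.
have sm : 2^-1 * (`|1 - kap p'| * beta) + enorm (pt_b p' - kap p' *: b) * alpha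
      - kap p' * delta < 0 by near: p'.
set b' := pt_b p' in sm *; set lam' := pt_lam p' in lam'0 *.
set k := kap p' in sm.
have k0 : 0 < k by rewrite divr_gt0.
have costE z r : cost A b' lam' z r = k * cost A b lam z r
    + (quad_loss A b' z - k * quad_loss A b z).
  have lamE : lam' = k * lam by rewrite mulfVK// gt_eqF.
  by rewrite /cost lamE; ring.
have onsphere z r : enorm (z - x) = eps -> support_bound C z r ->
    cost A b' lam' x rho < cost A b' lam' z r.
  move=> zS zC; rewrite !costE.
  have : k * (cost A b lam x rho + delta) <= k * cost A b lam z r.
    by rewrite ler_pM2l//; exact: sphere.
  set d := z - x; have -> : z = x + d by rewrite subrKC.
  rewrite !quad_lossD -!dotv_mulmxr !dotvBl.
  have hd : enorm (A *m d) <= alpha by rewrite /alpha -zS; exact: sigma_max_ineq.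
  have h1 : `|dotv (b' - k *: b) (A *m d)| <= enorm (b' - k *: b) * alpha.
    apply: le_trans (norm_dotv_le _ _) _; apply: ler_wpM2l => //.
    exact: enorm_ge0.
  have alpha0 := le_trans (enorm_ge0 _) hd.
  have h2 : `|dotv (A *m d) (A *m d) + 2 * dotv (A *m x) (A *m d)| <= beta.
    apply: le_trans (ler_normD _ _) _; rewrite normrM (ger0_norm (dotv_ge0 _)).
    rewrite /beta -sqr_enorm normr_nat -mulrA; apply: lerD.
      by rewrite ler_pXn2r ?nnegrE ?enorm_ge0.
    rewrite ler_wpM2l//; apply: le_trans (norm_dotv_le _ _) _.
    by rewrite ler_wpM2l// enorm_ge0.
  have h3 : `|(1 - k) * (dotv (A *m d) (A *m d) + 2 * dotv (A *m x) (A *m d))|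
      <= `|1 - k| * beta by rewrite normrM ler_wpM2l.
  move: h1 h3; rewrite !ler_norml dotvBl dotvZl.
  move=> /andP[_ h1] /andP[h3 _]; move: h1 h3 sm.
  move: (dotv b' _) (dotv b _) (dotv (A *m d) _) (dotv (A *m x) _) (cost _ _ _ _ _).
  move: (quad_loss _ _ _) (quad_loss _ _ _) (enorm _ * alpha) (`|1 - k| * beta).
  move: (cost _ _ _ _ _).
  move=> t1 t2 t3 t4 t5 t6 t7 t8 t9 t10; nra.
have outside z r : eps <= enorm (z - x) -> support_bound C z r ->
    cost A b' lam' x rho < cost A b' lam' z r.
  move=> zS zC; have N0 : 0 < enorm (z - x) by exact: lt_le_trans zS.
  set s := eps / enorm (z - x).
  have s0 : 0 < s by rewrite divr_gt0.
  have s1 : s <= 1 by rewrite ler_pdivrMr// mul1r.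
  have s01 : 0 <= s <= 1 by rewrite (ltW s0).
  have /onsphere : enorm (x + s *: (z - x) - x) = eps.
    by rewrite addrAC subrr add0r enormZ gtr0_norm// mulfVK// gt_eqF.
  move=> /(_ _ (support_bound_convex hx zC s01)) h.
  have := lt_le_trans h (cost_convex A b' lam' x rho z r s01).
  by rewrite ltrDl pmulr_rgt0// subr_gt0.
split=> //; last first.
  move=> z [r [zC zmin]]; rewrite ltNge; apply/negP => zS.
  by have := outside _ _ zS zC; rewrite ltNge zmin.
have Bcl : closed [set z | enorm (z - x) <= eps].
  rewrite (_ : [set _ | _] = (fun z => enorm (z - x)) @^-1` [set r | r <= eps])//.
  by apply: preimage_closed => [z _|]; [exact: cball|exact: closed_le].
have Bx : enorm (x - x) <= eps by rewrite subrr enorm0 ltW.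
have [z [r [zS zC zmin]]] := cost_min_on_compact b' lam'0 bound Bcl Bx hx.
exists z, r; split=> // z' r' z'C.
have [z'S|/ltW z'S] := lerP (enorm (z' - x)) eps; first exact: zmin.
apply: le_trans (ltW (outside _ _ z'S z'C)).
by apply: zmin => //=; rewrite subrr enorm0 ltW.
Unshelve. all: by end_near. Qed.

End Existence.

(** * Functions that are affine along the segments from a point *)

Section RadiallyAffine.
Context {R : realType}.
Variables (N n : nat).
Implicit Types (f : 'cV[R]_N -> 'cV[R]_n) (p q d h : 'cV[R]_N).

Definition radially_affine f p (e : R) := forall q s, enorm (q - p) < e ->
  0 <= s <= 1 -> f (p + s *: (q - p)) = f p + s *: (f q - f p).

Lemma radial_quotient f p e d s t : radially_affine f p e ->
  0 < s -> 0 < t -> enorm (s *: d) < e -> enorm (t *: d) < e ->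
  s^-1 *: (f (p + s *: d) - f p) = t^-1 *: (f (p + t *: d) - f p).
Proof.
move=> fr; wlog st : s t / s <= t.
  move=> th s0 t0 se te; have [/th|/ltW/th] := lerP s t; first exact.
  by move=> ->.
move=> s0 t0 se te.
have := fr (p + t *: d) (s / t); rewrite addrAC subrr add0r => /(_ te).
have -> : 0 <= s / t <= 1.
  by rewrite ler_pdivrMr// mul1r st andbT ltW// divr_gt0.
move=> /(_ isT); rewrite scalerA divfK ?gt_eqF// => ->.
rewrite addrAC subrr add0r scalerA; congr (_ *: _).
by field; rewrite !gt_eqF.
Qed.

Lemma radial_dir_derivative f p e d t : radially_affine f p e ->
  0 < t -> enorm (t *: d) < e ->
  is_dir_derivative f p d (t^-1 *: (f (p + t *: d) - f p)).
Proof.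
move=> fr t0 te; rewrite /is_dir_derivative.
apply: cvg_near_cst; near=> s.
have st : s <= t by near: s; apply: nbhs_right_le.
have s0 : 0 < s by near: s; exact: nbhs_right_gt.
apply: (radial_quotient fr s0 t0 _ te).
apply: le_lt_trans te; rewrite !enormZ ler_wpM2r ?enorm_ge0//.
by rewrite !gtr0_norm.
Unshelve. all: by end_near. Qed.

Lemma jac_mul f u h : differentiable f u -> jac f u *m h = 'd f u h.
Proof.
move=> df; apply/colP => i; rewrite mxE.
have hE : h = \sum_j h j 0 *: (delta_mx j 0 : 'cV[R]_N).
  apply/colP => k; rewrite summxE (bigD1 k)//= !mxE !eqxx mulr1 big1 ?addr0// => j jk.
  by rewrite !mxE eq_sym (negPf jk) mulr0.
rewrite [in RHS]hE linear_sum summxE; apply: eq_bigr => j _.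
by rewrite linearZ !mxE mulrC.
Qed.

(** The one-sided difference quotients of [f] at [u] towards [p] are constant. *)
Lemma radial_jac f p e u : radially_affine f p e -> enorm (u - p) < e ->
  differentiable f u -> jac f u *m (u - p) = f u - f p.
Proof.
move=> fr ue df; rewrite jac_mul//.
have dd : derivable f u (p - u) by exact: diff_derivable.
have h1 : (fun t : R => t^-1 *: (f (t *: (p - u) + u) - f u)) @ 0^'+ -->
    'd f u (p - u).
  rewrite -deriveE//.
  apply: cvg_trans dd; apply: cvg_app; apply: within_subset => t /=.
  by move=> /gt_eqF/negbT.
have h2 : (fun t : R => t^-1 *: (f (t *: (p - u) + u) - f u)) @ 0^'+ --> f p - f u.
  apply: cvg_near_cst; near=> t.
  have t0 : 0 < t by near: t; exact: nbhs_right_gt.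
  have t1 : t <= 1 by near: t; apply: nbhs_right_le.
  have -> : t *: (p - u) + u = p + (1 - t) *: (u - p).
    by apply/colP => i; rewrite !mxE; ring.
  rewrite fr//; last by lra.
  apply/colP => i; rewrite !mxE; field; rewrite gt_eqF//.
have h3 := cvg_unique (@norm_hausdorff _ _) h1 h2.
by rewrite -[u - p]opprB linearN h3 opprB.
Unshelve. all: by end_near. Qed.

Lemma locally_lipschitz_ball f p : locally_lipschitz_at f p ->
  exists K e, [/\ 0 <= K, 0 < e & forall x y, enorm (x - p) < e -> enorm (y - p) < e ->
    enorm (f x - f y) <= K * enorm (x - y)].
Proof.
move=> [K [[U V] /= [/near_enorm_ball[e1 e10 U1] /near_enorm_ball[e2 e20 V1]] UV]].
exists (Num.max K 0), (Num.min e1 e2); split.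
- by rewrite le_max lexx orbT.
- by rewrite lt_min e10.
move=> x y; rewrite !lt_min => /andP[xe _] /andP[_ ye].
apply: le_trans (UV (x, y) _) _ => /=; first by split; [exact: U1|exact: V1].
by rewrite ler_wpM2r ?enorm_ge0// le_max lexx.
Qed.

Lemma radial_clarke f p e K q V : radially_affine f p e ->
  (forall x y, enorm (x - p) < e -> enorm (y - p) < e ->
    enorm (f x - f y) <= K * enorm (x - y)) ->
  enorm (q - p) < e -> clarke_jacobian f q V -> V *m (q - p) = f q - f p.
Proof.
move=> fr fK qe [k [c [d [c0 c1 dV ->]]]].
rewrite mulmx_suml; under eq_bigr => i _.
  rewrite -scalemxAl; have [u [uq du uV]] := dV i.
  have une : \forall j \near \oo, enorm (u j - p) < e.
    have : (fun j => enorm (u j - p)) @ \oo --> enorm (q - p).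
      by apply: (cvg_enorm (F := \oo)); apply: (cvgB (F := \oo)) => //; exact: cvg_cst.
    by move=> /cvg_near_lt; apply.
  have fuq : (fun j => f (u j)) @ \oo --> f q.
    apply/cvg_ballP => r r0.
    have lim : (fun j => K * enorm (u j - q)) @ \oo --> K * enorm (q - q).
      apply: (cvgM (F := \oo)); first exact: cvg_cst.
      by apply: (cvg_enorm (F := \oo)); apply: (cvgB (F := \oo)) => //; exact: cvg_cst.
    rewrite subrr enorm0 mulr0 in lim.
    apply: filterS (filterI une (cvg_near_lt lim r0)) => j [uj Kj].
    rewrite -ball_normE /=; apply: le_lt_trans (mx_norm_le_enorm _) _.
    by rewrite enorm_sub; apply: le_lt_trans (fK _ _ uj qe) Kj.
  have h1 : (fun j => jac f (u j) *m (u j - p)) @ \oo --> d i *m (q - p).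
    by apply: (cvg_mulmx (F := \oo)) => //; apply: (cvgB (F := \oo)) => //; exact: cvg_cst.
  have h2 : (fun j => jac f (u j) *m (u j - p)) @ \oo --> f q - f p.
    apply: (@cvg_trans _ ((fun j => f (u j) - f p) @ \oo)); last first.
      by apply: (cvgB (F := \oo)) => //; exact: cvg_cst.
    apply: near_eq_cvg; move: une; apply: filterS => j uj.
    by rewrite (radial_jac fr uj (du j)).
  rewrite (cvg_unique (@norm_hausdorff _ _) h1 h2); over.
by rewrite -scaler_suml c1 scale1r.
Qed.

(** All elements [V] of the Clarke Jacobian at [p + t h'] give [V h'] the value of
    the difference quotient, by [radial_clarke]; by Lipschitz continuity it is
    close to the quotient in direction [h], which does not depend on [t]. *)
Lemma radial_semismooth f p e : 0 < e -> radially_affine f p e ->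
  locally_lipschitz_at f p -> semismooth_at f p.
Proof.
move=> e0 fr fl; split=> // h.
have [K [e1 [K0 e10 fK]]] := locally_lipschitz_ball fl.
pose r := Num.min e e1.
have r0 : 0 < r by rewrite lt_min e0.
have {}fr : radially_affine f p r.
  by move=> q s; rewrite lt_min => /andP[qe _]; exact: fr.
have {}fK x y : enorm (x - p) < r -> enorm (y - p) < r ->
    enorm (f x - f y) <= K * enorm (x - y).
  by rewrite !lt_min => /andP[_ xe] /andP[_ ye]; exact: fK.
(* [p + t h'] stays in the ball for [t <= t0] and [h'] at distance below 1 of [h] *)
pose t0 := r / (enorm h + 2).
have hp : 0 < enorm h + 2 by rewrite ltr_wpDl ?enorm_ge0.
have t00 : 0 < t0 by rewrite divr_gt0.
have small t h' : 0 < t -> t <= t0 -> enorm (h' - h) < 1 -> enorm (t *: h') < r.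
  move=> tp tt0 hh'; rewrite enormZ gtr0_norm//.
  have : enorm h' < enorm h + 2.
    by rewrite -[h'](subrK h); apply: le_lt_trans (enormD _ _) _; lra.
  move=> h'2; apply: (@le_lt_trans _ _ (t0 * enorm h')).
    by rewrite ler_wpM2r ?enorm_ge0.
  by rewrite /t0 -mulrA -ltr_pdivlMl// mulVf ?gt_eqF// mulrC ltr_pdivrMr// mul1r.
have h01 : enorm (h - h) < 1 by rewrite subrr enorm0.
exists (t0^-1 *: (f (p + t0 *: h) - f p)) => ep ep0.
near=> h' t => V VV.
have tp : 0 < t by near: t; exact: nbhs_right_gt.
have tt0 : t <= t0 by near: t; exact: nbhs_right_le.
have hh'1 : enorm (h' - h) < 1 by near: h'; exact: near_enorm_lt.
have hh'e : enorm (h' - h) < ep / (K + 1).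
  by near: h'; apply: near_enorm_lt; rewrite divr_gt0// ltr_wpDl.
have th' := small t h' tp tt0 hh'1.
have th := small t h tp tt0 h01.
have pE g : p + t *: g - p = t *: g by rewrite addrAC subrr add0r.
have := radial_clarke fr fK _ VV; rewrite pE => /(_ th').
rewrite -scalemxAr => Vh'.
rewrite (radial_quotient fr t00 tp (small t0 h t00 (lexx _) h01) th).
have -> : V *m h' - t^-1 *: (f (p + t *: h) - f p) =
    t^-1 *: (f (p + t *: h') - f (p + t *: h)).
  rewrite -[V *m h']scale1r -(mulVf (_ : t != 0)) ?gt_eqF// -scalerA Vh'.
  by rewrite -scalerBr opprB addrA subrK.
rewrite enormZ gtr0_norm ?invr_gt0//.
apply: (@le_lt_trans _ _ (t^-1 * (K * enorm (t *: (h' - h))))).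
  rewrite ler_wpM2l ?invr_ge0 ?(ltW tp)//.
  apply: le_trans (fK _ _ _ _) _; rewrite ?pE//.
  by rewrite opprD addrACA subrr add0r scalerBr.
rewrite enormZ gtr0_norm// mulrCA mulKf ?gt_eqF//.
move: hh'e; rewrite ltr_pdivlMr ?ltr_wpDl//.
by have := enorm_ge0 (h' - h); nra.
Unshelve. all: by end_near. Qed.

Lemma lip_modulus_le f p (K : R) :
  (forall e, 0 < e -> \forall x \near p & y \near p,
    enorm (f x - f y) <= (K + e) * enorm (x - y)) ->
  (lip_modulus f p <= K%:E)%E.
Proof.
move=> h; apply/lee_addgt0Pr => e e0; rewrite -EFinD.
pose V : set ('cV[R]_N * 'cV[R]_N) := [set xy | xy.1 <> xy.2 /\
  enorm (f xy.1 - f xy.2) / enorm (xy.1 - xy.2) <= K + e].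
apply: (@le_trans _ _ (ereal_sup ((fun xy : 'cV[R]_N * 'cV[R]_N =>
       (enorm (f xy.1 - f xy.2) / enorm (xy.1 - xy.2))%:E) @` V))).
  apply: ereal_inf_lbound; exists V => //.
  have := h e e0; rewrite /within /=; apply: filterS => -[x y] /= xy ne.
  split=> //=; rewrite ler_pdivrMr// enorm_gt0// subr_eq0; exact/eqP.
by apply: ge_ereal_sup => _ [xy [_ xyV] <-]; rewrite lee_fin.
Qed.

End RadiallyAffine.

(** * The solution map near the reference point *)

Section LocalSolution.
Context {R : realType}.
Variables (m n : nat) (A : 'M[R]_(m, n)) (C : set 'cV[R]_n).
Hypotheses (pC : polyhedron C) (C0 : C !=set0).
Implicit Types (p d : 'cV[R]_(m + 1)) (x z : 'cV[R]_n).

Definition dual_at p x := dual_point A (pt_b p) (pt_lam p) x.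

Definition kkt p x := 0 < pt_lam p /\ normal_cone C (dual_at p x) x.

Lemma kktP p x : kkt p x <-> 0 < pt_lam p /\ minimizer A C (pt_b p) (pt_lam p) x.
Proof. by split=> -[lam0 h]; split=> //; apply/minimizerP. Qed.

Lemma dual_atE p x : 0 < pt_lam p ->
  pt_lam p *: dual_at p x = A^T *m (pt_b p - A *m x).
Proof. by move=> lam0; rewrite scalerA divff ?gt_eqF// scale1r. Qed.

Lemma cvg_dual_at (T : Type) (F : set_system T) {FF : Filter F}
    (f : T -> 'cV[R]_(m + 1)) (g : T -> 'cV[R]_n) p x :
  0 < pt_lam p -> f @ F --> p -> g @ F --> x ->
  (fun t => dual_at (f t) (g t)) @ F --> dual_at p x.
Proof.
move=> lam0 fp gx; apply: cvgZ.
  by apply: cvgV; [rewrite gt_eqF|exact: cvg_pt_lam].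
apply: cvg_mulmx; first exact: cvg_cst.
apply: cvgB; first exact: cvg_pt_b.
by apply: cvg_mulmx; first exact: cvg_cst.
Qed.

(** The solutions for one parameter share their residual, by monotonicity of the
    normal cone. *)
Lemma dual_at_unique p x x' : kkt p x -> kkt p x' -> dual_at p x = dual_at p x'.
Proof.
move=> [lam0 hx] [_ hx'].
suff Axx' : A *m (x - x') = 0.
  by rewrite /dual_at /dual_point -[A *m x](subrK (A *m x')) -mulmxBr Axx' add0r.
apply: dotv_eq0; apply/eqP; rewrite eq_le dotv_ge0 andbT -oppr_ge0.
have : 0 <= pt_lam p * dotv (x - x') (dual_at p x - dual_at p x').
  exact: mulr_ge0 (ltW lam0) (normal_cone_monotone hx hx').
rewrite -dotvZr scalerBr !dual_atE// -mulmxBr -dotv_mulmxl.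
have -> : pt_b p - A *m x - (pt_b p - A *m x') = - (A *m (x - x')).
  by rewrite mulmxBr opprD addrACA subrr add0r opprB opprK addrC.
by rewrite dotvNr.
Qed.

Variables (pb : 'cV[R]_(m + 1)) (xb : 'cV[R]_n).
Hypothesis kktb : kkt pb xb.
Let v := dual_at pb xb.
Hypothesis ker_span : forall z, A *m z = 0 -> lin_span (normal_cone C v) z -> z = 0.

(** What polyhedrality provides at the solutions near the reference point: see
    [normal_cone_near]. *)
Definition regular p x := [/\ kkt p x, normal_cone C (dual_at p x) `<=` normal_cone C v
  & normal_cone C (dual_at p x) xb].

Lemma regular_ref : regular pb xb.
Proof. by split=> //; have [] := kktb. Qed.

(** A second solution has the same dual point, so it lies in the normal cone at [v]
    as well; the difference then lies in the kernel of [A] and in the span. *)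
Lemma regular_unique p x x' : regular p x -> kkt p x' -> x' = x.
Proof.
move=> [kx sub _] kx'; have dE := dual_at_unique kx kx'.
apply/eqP; rewrite -subr_eq0; apply/eqP/ker_span; last first.
  by apply: lin_spanB; apply: sub; [rewrite dE; have [] := kx'|have [] := kx].
have [lam0 _] := kx.
have AA : A^T *m (A *m (x' - x)) = 0.
  have := congr1 (fun w => pt_lam p *: w) dE; rewrite !dual_atE// => /eqP.
  rewrite -subr_eq0 -mulmxBr => /eqP.
  by rewrite (_ : _ - _ = A *m (x' - x))// mulmxBr; apply/colP => i; rewrite !mxE; ring.
by apply: dotv_eq0; rewrite dotv_mulmxr AA dot0v.
Qed.

Lemma regular_span p1 x1 p2 x2 : regular p1 x1 -> regular p2 x2 ->
  lin_span (normal_cone C v) (x1 - x2).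
Proof.
by move=> [[_ h1] sub1 _] [[_ h2] sub2 _]; apply: lin_spanB; [exact: sub1|exact: sub2].
Qed.

Lemma basis_injective (D : set 'cV[R]_n) k (Q : 'M[R]_(n, k)) (c : 'cV[R]_k) :
  D `<=` normal_cone C v -> orthonormal_basis Q (lin_span D) ->
  A *m Q *m c = 0 -> c = 0.
Proof.
move=> sub [QQ QW]; rewrite -mulmxA => AQc0.
have Qc0 : Q *m c = 0.
  by apply: (ker_span AQc0); apply: (sub_lin_span sub); rewrite QW; exists c.
by rewrite -[c]mul1mx -QQ -mulmxA Qc0 mulmx0.
Qed.

(** The dual point is a continuous function of parameter and solution. *)
Lemma near_regular : \forall p \near pb & x \near xb, kkt p x -> regular p x.
Proof.
have [lamb0 [Cv _]] := kktb.
have [[U V] /= [Ux Vv] UV] := normal_cone_near xb pC Cv.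
have cd : (fun px : 'cV[R]_(m + 1) * 'cV[R]_n => dual_at px.1 px.2)
    @ filter_prod (nbhs pb) (nbhs xb) --> v.
  by apply: cvg_dual_at => //; [exact: cvg_fst|exact: cvg_snd].
have [[U' V'] /= [U'p V'x] UV'] := cd _ Vv.
exists (U', U `&` V') => //=; first by split=> //; exact: filterI.
move=> [p x] /= [U'p' [Ux' V'x']] [lam0 hx]; split=> //.
- by have [] := UV (x, dual_at p x) (conj Ux' (UV' (p, x) (conj U'p' V'x'))) hx.
- by have [] := UV (x, dual_at p x) (conj Ux' (UV' (p, x) (conj U'p' V'x'))) hx.
Qed.

Definition sol p : 'cV[R]_n := xget 0 [set x | kkt p x].

Lemma sol_near eps : 0 < eps ->
  \forall p \near pb, kkt p (sol p) /\ enorm (sol p - xb) < eps.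
Proof.
move=> eps0; have /kktP[lamb0 minb] := kktb.
have uniqb x : minimizer A C (pt_b pb) (pt_lam pb) x -> x = xb.
  by move=> minx; apply: (regular_unique regular_ref); exact/kktP.
apply: filterS (minimizer_stable C0 lamb0 minb uniqb eps0) => p [lam0 [x minx] loc].
have solp : kkt p (sol p) by apply: (xgetPex 0); exists x; apply/kktP.
by split=> //; apply: loc; have /kktP[] := solp.
Qed.

Lemma sol_regular : exists2 e, 0 < e & forall p, enorm (p - pb) < e -> regular p (sol p).
Proof.
have [[U V] /= [Up /near_enorm_ball[eps eps0 epsV]] UV] := near_regular.
apply: (@near_enorm_ball _ _ pb [set p | regular p (sol p)]); 
near=> p.
have Up' : U p by near: p.
have [ksol solx] : kkt p (sol p) /\ enorm (sol p - xb) < eps by near: p; exact: sol_near.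
by apply: (UV (p, sol p)) => //=; split=> //; exact: epsV.
Unshelve. all: by end_near. Qed.

Lemma sol_ref : sol pb = xb.
Proof. by apply: (regular_unique regular_ref); apply: (xgetPex 0); exists xb. Qed.

(** The optimality conditions persist along the segment from the reference pair
    to a regular pair: both solutions lie in the normal cone at the dual point of
    the latter, hence at every point between the two dual points. *)
Lemma kkt_segment p x s : regular p x -> 0 <= s <= 1 ->
  kkt (pb + s *: (p - pb)) (xb + s *: (x - xb)).
Proof.
move=> [[lam0 hx] sub hxb] s01; have /andP[s0 s1] := s01.
have [lamb0 hxbv] := kktb.
set q := pb + _; set y := xb + _; set w := dual_at p x in hx sub hxb.
have lamqE : pt_lam q = (1 - s) * pt_lam pb + s * pt_lam p.
  by rewrite /pt_lam /q !mxE; ring.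
have lamq0 : 0 < pt_lam q by rewrite lamqE; nra.
split=> //.
have yE : y = (1 - s) *: xb + s *: x.
  by rewrite /y; apply/colP => i; rewrite !mxE; ring.
pose t := s * pt_lam p / pt_lam q.
have t01 : 0 <= t <= 1.
  rewrite divr_ge0 ?mulr_ge0 ?(ltW lam0) ?(ltW lamq0)//= ler_pdivrMr// mul1r lamqE.
  by rewrite lerDr mulr_ge0 ?(ltW lamb0)// subr_ge0.
have -> : dual_at q y = (1 - t) *: v + t *: w.
  apply: (@scalerI _ _ (pt_lam q)); first by rewrite gt_eqF.
  rewrite dual_atE// scalerDr !scalerA.
  have -> : pt_lam q * t = s * pt_lam p by rewrite mulrC divfK// gt_eqF.
  have -> : pt_lam q * (1 - t) = (1 - s) * pt_lam pb.
    by rewrite mulrBr mulr1 [pt_lam q * t]mulrC divfK ?gt_eqF// lamqE addrK.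
  rewrite -!scalerA !dual_atE// -!linearZ -mulmxDr; congr (_ *m _).
  have -> : pt_b q = (1 - s) *: pt_b pb + s *: pt_b p.
    by apply/colP => i; rewrite !mxE; ring.
  rewrite yE mulmxDr -!scalemxAr; apply/colP => i; rewrite !mxE; ring.
have base u : normal_cone C w u -> normal_cone C ((1 - t) *: v + t *: w) u.
  by move=> wu; apply: normal_cone_base_convex => //; exact: sub.
rewrite yE; apply: normal_cone_convex => //; exact: base.
Qed.

Lemma sol_radial e : (forall p, enorm (p - pb) < e -> regular p (sol p)) ->
  radially_affine sol pb e.
Proof.
move=> reg q s qe s01; rewrite sol_ref; symmetry.
apply: (@regular_unique (pb + s *: (q - pb))); last first.
  by apply: kkt_segment => //; exact: reg.
apply: reg; rewrite addrAC subrr add0r enormZ; apply: le_lt_trans qe.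
have /andP[s0 s1] := s01; rewrite ger0_norm//.
by rewrite ler_piMl// enorm_ge0.
Qed.

Lemma pair_dotv p : dotv p p = dotv (pt_b p) (pt_b p) + pt_lam p ^+ 2.
Proof.
rewrite /dotv -[in LHS](vsubmxK p) tr_col_mx mul_row_col mxE; congr (_ + _).
by rewrite mxE big_ord1 mxE.
Qed.

Lemma enorm_pt_b p : enorm (pt_b p) <= enorm p.
Proof. by rewrite /enorm ler_wsqrtr// pair_dotv lerDl sqr_ge0. Qed.

Lemma norm_pt_lam p : `|pt_lam p| <= enorm p.
Proof. by rewrite -sqrtr_sqr ler_wsqrtr// pair_dotv lerDr dotv_ge0. Qed.

(** Subtract the two optimality conditions and pair with the difference of the
    solutions, which is [Q c]: monotonicity of the normal cone disposes of the
    difference of the dual points. *)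
Lemma regular_gap k (Q : 'M[R]_(n, k)) p1 x1 p2 x2 :
  orthonormal_basis Q (lin_span (normal_cone C v)) -> regular p1 x1 -> regular p2 x2 ->
  sigma_min (A *m Q) ^+ 2 * enorm (x1 - x2) <=
    (sigma_max (A *m Q) + enorm (Q^T *m dual_at p2 x2)) * enorm (p1 - p2).
Proof.
move=> [QQ QW] r1 r2; have [[lam1 h1] _ _] := r1; have [[lam2 h2] _ _] := r2.
set w1 := dual_at p1 x1 in h1; set w2 := dual_at p2 x2 in h2 *.
have [c cE] : [set x | exists c, x = Q *m c] (x1 - x2).
  by rewrite -QW; exact: regular_span r1 r2.
have smax0 := sigma_max_ge0 (A *m Q).
rewrite cE orthonormal_enorm//.
have [->|c0] := eqVneq c 0.
  by rewrite enorm0 mulr0 mulr_ge0 ?addr_ge0 ?enorm_ge0.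
have cp := enorm_gt0 c0.
rewrite -(ler_pM2r cp) -mulrA -expr2 sqr_enorm.
apply: le_trans (sigma_min_ineq _ _) _; rewrite -!mulmxA -cE.
have mono : 0 <= pt_lam p1 * dotv (x1 - x2) (w1 - w2).
  exact: mulr_ge0 (ltW lam1) (normal_cone_monotone h1 h2).
have e1 : pt_lam p1 * dotv (x1 - x2) w1 = dotv (A *m (x1 - x2)) (pt_b p1 - A *m x1).
  by rewrite -dotvZr dual_atE// dotv_mulmxl.
have e2 : pt_lam p2 * dotv (x1 - x2) w2 = dotv (A *m (x1 - x2)) (pt_b p2 - A *m x2).
  by rewrite -dotvZr dual_atE// dotv_mulmxl.
have bE : pt_b (p1 - p2) = pt_b p1 - pt_b p2 by apply/colP => i; rewrite !mxE.
have lamE : pt_lam (p1 - p2) = pt_lam p1 - pt_lam p2 by rewrite /pt_lam !mxE.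
have main : dotv (A *m (x1 - x2)) (A *m (x1 - x2)) <=
    dotv (A *m (x1 - x2)) (pt_b (p1 - p2)) - pt_lam (p1 - p2) * dotv (x1 - x2) w2.
  have -> : dotv (A *m (x1 - x2)) (A *m (x1 - x2)) =
      dotv (A *m (x1 - x2)) (A *m x1) - dotv (A *m (x1 - x2)) (A *m x2).
    by rewrite -dotvBr mulmxBr.
  move: mono e1 e2; rewrite bE lamE !dotvBr; lra.
apply: le_trans main _; rewrite mulrDl mulrDl; apply: lerD.
  apply: le_trans (dotv_le_enorm _ _) _; rewrite cE mulmxA mulrAC.
  apply: ler_pM; rewrite ?enorm_ge0//; first exact: sigma_max_ineq.
  exact: enorm_pt_b.
rewrite -mulrN; apply: le_trans (ler_norm _) _; rewrite normrM normrN mulrAC mulrC.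
apply: ler_pM; rewrite ?normr_ge0//; last exact: norm_pt_lam.
by rewrite cE dotv_mulmxl mulrC; exact: norm_dotv_le.
Qed.

Lemma gram_unit j k (B : 'M[R]_(j, k)) :
  (forall c : 'cV[R]_k, B *m c = 0 -> c = 0) -> B^T *m B \in unitmx.
Proof.
move=> Binj; rewrite -row_free_unit -kermx_eq0; apply/eqP/row_matrixP => i.
rewrite row0; apply: trmx_inj; rewrite trmx0; apply/Binj/dotv_eq0.
have uG := sub_kermxP (row_sub i (kermx (B^T *m B))).
by rewrite -dotv_gram -[X in dotv _ X]trmxK trmx_mul gram_sym trmxK uG trmx0 dotv0.
Qed.

(** On the span of the normal cone at the dual point of a nearby solution the
    difference quotient solves a least-squares problem: there the dual points
    act alike, so only the factor [lam] in front of them varies. *)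
Lemma regular_quotient p x k (Q : 'M[R]_(n, k)) (q : 'cV[R]_m) (alpha t : R) :
  t != 0 -> p - pb = t *: pair_pt q alpha -> regular p x ->
  orthonormal_basis Q (lin_span (normal_cone C (dual_at p x))) ->
  (A *m Q)^T *m (A *m Q) \in unitmx /\
  t^-1 *: (x - xb) = Q *m invmx ((A *m Q)^T *m (A *m Q)) *m (A *m Q)^T
    *m (q + (alpha / pt_lam pb) *: (A *m xb - pt_b pb)).
Proof.
move=> t0 pE [[lam0 hx] sub hxb] QB; have [QQ QW] := QB.
have [lamb0 hv] := kktb; set w := dual_at p x in hx sub hxb QB QW.
have G := gram_unit (fun c => @basis_injective _ _ Q c sub QB); split=> //.
have [c cE] : [set y | exists c, y = Q *m c] (t^-1 *: (x - xb)).
  rewrite -QW -[_ *: _]addr0; apply: lin_span_linear (lin_span0 _).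
  exact: lin_spanB.
have Qw : Q^T *m w = Q^T *m v.
  apply/eqP; rewrite -subr_eq0 -mulmxBr; apply/eqP/dotv_eq0.
  rewrite -dotv_mulmxl dotvC; apply: (@dotv_lin_span _ _ (normal_cone C w)).
    move=> u wu; have := normal_cone_orth (sub _ wu) wu.
    by rewrite dotvBl !(dotvC _ u) => ->; rewrite subrr.
  by rewrite QW; eexists.
have [Qv QvE] : exists y, y = Q^T *m v by eexists.
rewrite -QvE in Qw.
have pbE : pt_b p = pt_b pb + t *: q.
  by rewrite -[p](subrK pb) pE /pt_b /pair_pt linearD/= linearZ/= col_mxKu addrC.
have plE : pt_lam p = pt_lam pb + t * alpha.
  by rewrite -[p](subrK pb) pE /pt_lam /pair_pt linearD/= linearZ/= col_mxKd !mxE addrC.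
rewrite cE -!mulmxA; congr (Q *m _).
apply: (can_inj (mulKmx G)); rewrite (mulKVmx G).
have Qdual p' x' : 0 < pt_lam p' ->
    pt_lam p' *: (Q^T *m dual_at p' x') = (A *m Q)^T *m (pt_b p' - A *m x').
  by move=> l0; rewrite scalemxAr dual_atE// mulmxA trmx_mul.
have AQv : (A *m Q)^T *m (A *m xb - pt_b pb) = - (pt_lam pb *: Qv).
  by rewrite QvE Qdual// -mulmxN opprB.
rewrite mulmxDr -scalemxAr AQv scalerN scalerA divfK ?gt_eqF//.
rewrite -!mulmxA -cE -!scalemxAr.
apply: (@scalerI _ _ t) => //; rewrite scalerA mulfV// scale1r.
have e1 : (A *m Q)^T *m (A *m x) = (A *m Q)^T *m pt_b p - pt_lam p *: Qv.
  by rewrite -Qw Qdual// mulmxBr opprB addrC subrK.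
have e2 : (A *m Q)^T *m (A *m xb) = (A *m Q)^T *m pt_b pb - pt_lam pb *: Qv.
  by rewrite QvE Qdual// mulmxBr opprB addrC subrK.
rewrite mulmxBr mulmxBr e1 e2 pbE plE mulmxDr -scalemxAr.
by apply/colP => i; rewrite !mxE; ring.
Qed.

Lemma sol_cvg : sol p @[p --> nbhs pb] --> xb.
Proof.
apply/cvg_ballP => eps eps0; near=> p.
have [_ h] : kkt p (sol p) /\ enorm (sol p - xb) < eps by near: p; exact: sol_near.
rewrite -ball_normE /=; apply: le_lt_trans (mx_norm_le_enorm _) _.
by rewrite enorm_sub.
Unshelve. all: by end_near. Qed.

(** [regular_gap] divided by the squared smallest singular value, with the dual point of
    [sol p2] replaced by its limit [v]. *)
Lemma sol_gap k (Q : 'M[R]_(n, k)) eps :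
  orthonormal_basis Q (lin_span (normal_cone C v)) -> 0 < eps ->
  \forall p1 \near pb & p2 \near pb, enorm (sol p1 - sol p2) <=
    ((sigma_min (A *m Q) ^+ 2)^-1 * (sigma_max (A *m Q) + enorm (Q^T *m v)) + eps)
      * enorm (p1 - p2).
Proof.
move=> QB eps0; have [e e0 reg] := sol_regular.
set smin := sigma_min _ ^+ 2; set smax := sigma_max _.
have smin0 : 0 <= smin by exact: sqr_ge0.
have [k0|k0] := posnP k.
  (* the span is trivial and [sol] is locally constant *)
  near=> p1 p2.
  have r1 : regular p1 (sol p1) by apply: reg; near: p1; exact: near_enorm_lt.
  have r2 : regular p2 (sol p2) by apply: reg; near: p2; exact: near_enorm_lt.
  have [_ QW] := QB.
  have [c ->] : [set x | exists c, x = Q *m c] (sol p1 - sol p2).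
    by rewrite -QW; exact: regular_span r1 r2.
  have c0 : c = 0 by apply/colP => -[i ik]; exfalso; move: ik; rewrite k0.
  rewrite c0 mulmx0 enorm0 mulr_ge0 ?enorm_ge0// addr_ge0 ?(ltW eps0)//.
  by rewrite mulr_ge0 ?invr_ge0// addr_ge0 ?enorm_ge0// sigma_max_ge0.
have sminp : 0 < smin.
  by apply: sigma_min_sqr_gt0 => // c; exact: (basis_injective (subset_refl _) QB).
have dualc : dual_at p (sol p) @[p --> nbhs pb] --> v.
  have [lamb0 _] := kktb.
  by apply: (cvg_dual_at (F := nbhs pb)) => //; exact: sol_cvg.
have Qdual : \forall p \near pb, enorm (Q^T *m dual_at p (sol p)) <
    enorm (Q^T *m v) + smin * eps.
  have lim : enorm (Q^T *m dual_at p (sol p)) @[p --> nbhs pb] --> enorm (Q^T *m v).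
    apply: (cvg_enorm (F := nbhs pb)); apply: (cvg_mulmx (F := nbhs pb)) => //.
    exact: cvg_cst.
  by apply: (cvg_near_lt lim); rewrite ltrDl mulr_gt0.
near=> p1 p2.
have r1 : regular p1 (sol p1) by apply: reg; near: p1; exact: near_enorm_lt.
have r2 : regular p2 (sol p2) by apply: reg; near: p2; exact: near_enorm_lt.
have Q2 : enorm (Q^T *m dual_at p2 (sol p2)) < enorm (Q^T *m v) + smin * eps.
  by near: p2.
have gap := regular_gap QB r1 r2; rewrite -/smin -/smax in gap.
rewrite -(ler_pM2l sminp); apply: le_trans gap _; rewrite [leRHS]mulrA.
apply: ler_wpM2r; first exact: enorm_ge0.
rewrite mulrDr mulrA divff ?gt_eqF// mul1r -addrA.
by rewrite lerD2l ltW.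
Unshelve. all: by end_near. Qed.

Lemma sol_semismooth : semismooth_at sol pb.
Proof.
have [e e0 reg] := sol_regular.
apply: (radial_semismooth e0 (sol_radial reg)).
have [k [Q QB]] := lin_span_basis (normal_cone C v).
by eexists; exact: (sol_gap QB ltr01).
Qed.

Lemma sol_dir_derivative (q : 'cV[R]_m) (alpha : R) :
  exists k (Q : 'M[R]_(n, k)), [/\ orthonormal_cols Q,
    (A *m Q)^T *m (A *m Q) \in unitmx
  & is_dir_derivative sol pb (pair_pt q alpha)
      (Q *m invmx ((A *m Q)^T *m (A *m Q)) *m (A *m Q)^T
         *m (q + (alpha / pt_lam pb) *: (A *m xb - pt_b pb)))].
Proof.
have [e e0 reg] := sol_regular; set d := pair_pt q alpha.
pose t := e / (enorm d + 1).
have dp : 0 < enorm d + 1 by rewrite ltr_wpDl ?enorm_ge0.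
have t0 : 0 < t by rewrite divr_gt0.
have te : enorm (t *: d) < e.
  rewrite enormZ gtr0_norm// /t mulrAC ltr_pdivrMr// ltr_pM2l//; lra.
have pE : pb + t *: d - pb = t *: d by rewrite addrAC subrr add0r.
have pr : regular (pb + t *: d) (sol (pb + t *: d)) by apply: reg; rewrite pE.
have [k [Q QB]] := lin_span_basis
  (normal_cone C (dual_at (pb + t *: d) (sol (pb + t *: d)))).
have [QQ _] := QB.
have [G quotE] := regular_quotient (lt0r_neq0 t0) pE pr QB.
exists k, Q; split=> //; rewrite -quotE -[X in _ - X]sol_ref.
exact: (radial_dir_derivative (sol_radial reg) t0 te).
Qed.

Lemma sol_lip_modulus k (Q : 'M[R]_(n, k)) :
  orthonormal_basis Q (lin_span (normal_cone C v)) ->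
  (lip_modulus sol pb <= ((sigma_min (A *m Q) ^+ 2)^-1
     * (sigma_max (A *m Q) + enorm (Q^T *m v)))%:E)%E.
Proof. by move=> QB; apply: lip_modulus_le => eps; exact: sol_gap. Qed.

End LocalSolution.

(** * Elimination of the matrix of the regularizer *)

(** The left-hand side depends on [y] through [M^T y] only, so all multipliers
    give the same span. *)
Lemma normal_cone_image (R : realType) n l (P : set 'cV[R]_l) (M : 'M[R]_(l, n)) y :
  P y -> [set x | normal_cone P y (M *m x)]
    = normal_cone [set M^T *m z | z in P] (M^T *m y).
Proof.
move=> Py; apply/seteqP; split=> x /= [_ h]; split=> //.
- by exists y.
- by move=> _ [z Pz <-]; rewrite -mulmxBr -dotv_mulmxl; exact: h.
- by move=> z Pz; rewrite dotv_mulmxl mulmxBr; apply: h; exists z.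
Qed.

(* s is the single-valued function that represents the set-valued map S near
   the reference point; every notion in the conclusion is local there. *)
Theorem corollary5p6 (R : realType) (m n l : nat)
    (A : 'M[R]_(m, n)) (P : set 'cV[R]_l) (M : 'M[R]_(l, n))
    (hP : polyhedron P) (hP0 : P !=set0)
    (b : 'cV[R]_m) (lam : R) (hlam : 0 < lam)
    (x : 'cV[R]_n) (hx : sol_map A P M (pair_pt b lam) x)
    (v : 'cV[R]_n) (hv : v = - (lam^-1 *: (A^T *m (A *m x - b))))
    (hker : forall y : 'cV[R]_l, multipliers P M x v y ->
       [set z : 'cV[R]_n | A *m z = 0] `&` cone_span P M y = [set 0]) :
  exists s : 'cV[R]_(m + 1) -> 'cV[R]_n,
    [/\ \forall p \near pair_pt b lam, sol_map A P M p = [set s p],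
        semismooth_at s (pair_pt b lam),
        forall (q : 'cV[R]_m) (alpha : R),
          exists k (Q : 'M[R]_(n, k)),
            [/\ orthonormal_cols Q,
                (A *m Q)^T *m (A *m Q) \in unitmx
              & is_dir_derivative s (pair_pt b lam) (pair_pt q alpha)
                  (Q *m invmx ((A *m Q)^T *m (A *m Q)) *m (A *m Q)^T
                     *m (q + (alpha / lam) *: (A *m x - b)))]
      & forall y : 'cV[R]_l, multipliers P M x v y ->
          forall k (Q : 'M[R]_(n, k)), orthonormal_basis Q (cone_span P M y) ->
            (lip_modulus s (pair_pt b lam)
             <= ((sigma_min (A *m Q) ^+ 2)^-1
                 * (sigma_max (A *m Q)
                    + lam^-1 * enorm ((A *m Q)^T *m (A *m x - b))))%:E)%E].
Proof.
pose C : set 'cV[R]_n := [set M^T *m y | y in P].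
have pC : polyhedron C by exact: polyhedron_image.
have C0 : C !=set0 by have [y Py] := hP0; exists (M^T *m y), y.
set pb := pair_pt b lam in hx *.
have bE : pt_b pb = b by rewrite /pt_b /pb /pair_pt col_mxKu.
have lamE : pt_lam pb = lam by rewrite /pt_lam /pb /pair_pt col_mxKd mxE.
have vE : v = dual_at A pb x.
  by rewrite hv /dual_at /dual_point bE lamE -scalerN -mulmxN opprB.
have solE p z : sol_map A P M p z <-> kkt A C p z.
  by rewrite kktP//; exact: sol_mapE.
have kx : kkt A C pb x by apply/solE.
have spanE y : multipliers P M x v y ->
    cone_span P M y = lin_span (normal_cone C (dual_at A pb x)).
  by move=> [yv [Py _]]; rewrite -vE /cone_span normal_cone_image// yv.
have [y0 y0v] : exists y, multipliers P M x v y.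
  have [_ xn] := kx; have [[y Py yv] _] := xn; exists y.
  rewrite -vE in yv xn; split=> //; rewrite /normal_cone_inv /=.
  by have : [set x | normal_cone P y (M *m x)] x by rewrite normal_cone_image// yv.
have ker z : A *m z = 0 -> lin_span (normal_cone C (dual_at A pb x)) z -> z = 0.
  by move=> Az Wz; have := hker _ y0v; rewrite (spanE _ y0v) => /seteqP[+ _]; apply.
exists (sol A C); split.
- have [e e0 reg] := sol_regular pC C0 kx ker.
  apply: (enorm_ball_near e0) => p /reg rp; apply/seteqP; split=> z /=.
    by move=> /solE; exact: (regular_unique ker rp).
  by move=> ->; apply/solE; have [] := rp.
- exact: (sol_semismooth pC C0 kx ker).
- by move=> q alpha; have := sol_dir_derivative pC C0 kx ker q alpha; rewrite bE lamE.
- move=> y yv k Q; rewrite (spanE _ yv) => QB.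
  have -> : lam^-1 * enorm ((A *m Q)^T *m (A *m x - b)) = enorm (Q^T *m dual_at A pb x).
    rewrite /dual_at /dual_point bE lamE -scalemxAr enormZ gtr0_norm ?invr_gt0//.
    by rewrite mulmxA -trmx_mul -opprB mulmxN enormN.
  exact: (sol_lip_modulus pC C0 kx ker QB).
Qed.
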